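(* Fix $T>0$, $x_0>0$, an integer $q\ge1$ and $H\in(\tfrac12,1)$, and let $a>0$, $b_1\ge0$, $|b_1|<b_0$, $T_{\mathrm{per}}>0$, $\sigma_0>0$. Assume there is a constant $C>0$ with $\|L^{H,q}_t-L^{H,q}_s\|_{L^2(\mathbb R^q)}\le C|t-s|^H$ for all $s,t\in[0,T]$. Put $b(t)=b_0+b_1\sin(2\pi t/T_{\mathrm{per}})$ and let $(X_t)_{t\in[0,T]}$ be the pathwise solution of $$dX_t=a\bigl(b(t)-X_t\bigr)\,dt+\sigma_0\,dZ^{(q,H)}_t,\qquad X_0=x_0.$$ Let $$m_0:=\min\bigl(x_0,\,b_0-|b_1|\bigr)>0,\qquad C_T:=\sup_{s\in[0,T]}\bigl|Z^{(q,H)}_s\bigr|.$$ Then, for every $p\ge1$, $$\mathbb P\bigl(X_t>0\ \text{for all }t\in[0,T]\bigr)\ \ge\ 1-\left(\frac{\sigma_0(2+aT)}{m_0}\right)^{p}\mathbb E\bigl[C_T^{\,p}\bigr].$$ Moreover $\mathbb E[C_T^p]<\infty$ for every $p\ge1$; in particular, for fixed $p,a,T,q,H$, the right-hand side tends to $1$ as $m_0/\sigma_0\to\infty$.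
   Context: Setting: $(\Omega,\mathcal F,\mathbb P)$ is the classical two-sided Wiener space with canonical two-sided Brownian motion $B$, and $I_q(f)$ denotes the $q$-th multiple Wiener–Itô integral with respect to $B$ of a symmetric $f\in L^2(\mathbb R^q)$. Hermite process: for an integer $q\ge1$ and $H\in(\tfrac12,1)$ set $H_0=1+\frac{H-1}{q}$ and $c(H,q)=\sqrt{\frac{H(2H-1)}{q!\,\beta(H_0-\frac12,\,2-2H_0)^q}}$, where $\beta(\cdot,\cdot)$ is the Beta function. The Hermite process is $Z^{(q,H)}_t=I_q(L^{H,q}_t)$, $t\ge0$, with kernel $L^{H,q}_t(\xi_1,\dots,\xi_q)=c(H,q)\int_0^t\prod_{j=1}^q(s-\xi_j)_+^{H_0-3/2}\,ds$, where $\theta_+^{r}=\theta^{r}\mathbf 1_{\theta>0}$. $Z^{(q,H)}$ is taken in a modification whose paths are $\lambda$-Hölder continuous on compacts for every $\lambda<H$. The stochastic differential equation is understood pathwise, i.e. almost surely $X_t=x_0+\int_0^t a(b(s)-X_s)\,ds+\sigma_0 Z^{(q,H)}_t$ for all $t\in[0,T]$ (stochastic integrals are Young–Riemann–Stieltjes integrals; $Z^{(q,H)}_0=0$). This is the case $\sigma_1=0$ of the general equation with diffusion coefficient $\tilde\sigma(x)=\sigma_0+\sigma_1\sqrt{\phi_\varepsilon(x)}$; the smoothness requirement that the drift and diffusion coefficients be $\mathcal C^3$ with bounded derivatives of orders $1,2,3$ holds automatically here. *)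

(* Defs.v *)
From HB Require Import structures.
From mathcomp Require Import all_boot all_order all_algebra.
From mathcomp Require Import all_classical all_reals all_analysis.

Set Implicit Arguments.
Unset Strict Implicit.
Unset Printing Implicit Defensive.
Import Order.TTheory GRing.Theory Num.Theory.
Import numFieldNormedType.Exports.

Local Open Scope classical_set_scope.
Local Open Scope ring_scope.

(* Lebesgue measure on R^n, with R^n rendered as n.-tuple R: the image of
   lebesgue_measure \x (Lebesgue measure on R^(n-1)) under (x, v) |-> x :: v.
   The recursion carries sigma-finiteness, which \x requires. *)
Section lebesgue_tuple.
Context {R : realType}.
Local Notation TR := (measurableTypeR R).
Local Notation leb := (@lebesgue_measure R).

Definition pcons n (x : TR * n.-tuple TR) : n.+1.-tuple TR :=
  [tuple of x.1 :: x.2].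

Lemma measurable_pcons n : measurable_fun [set: TR * n.-tuple TR] (@pcons n).
Proof. by apply: measurable_cons. Qed.

HB.instance Definition _ n :=
  isMeasurableFun.Build _ _ _ _ (@pcons n) (@measurable_pcons n).

Section lebesgue_tupleS.
Variables (n : nat) (mu : {sigma_finite_measure set (n.-tuple TR) -> \bar R}).

Definition lebesgue_tupleS : set (n.+1.-tuple TR) -> \bar R :=
  pushforward (leb \x mu)%E (@pcons n).

Let lebesgue_tupleS0 : lebesgue_tupleS set0 = 0%E.
Proof. by rewrite /lebesgue_tupleS /pushforward preimage_set0 measure0. Qed.

Let lebesgue_tupleS_ge0 A : (0 <= lebesgue_tupleS A)%E.
Proof. exact: measure_ge0. Qed.

Let lebesgue_tupleS_sigma_additive : semi_sigma_additive lebesgue_tupleS.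
Proof.
apply: (@measure_semi_sigma_additive _ _ _
  (pushforward (leb \x mu)%E (@pcons n))).
exact: measurable_pcons.
Qed.

HB.instance Definition _ := isMeasure.Build _ _ _ lebesgue_tupleS
  lebesgue_tupleS0 lebesgue_tupleS_ge0 lebesgue_tupleS_sigma_additive.

Let lebesgue_tupleS_sigma_finite : sigma_finite setT lebesgue_tupleS.
Proof.
have /sigma_finiteP[F [FT ndF Foo]] := sigma_finiteT leb.
have /sigma_finiteP[G [GT ndG Goo]] := sigma_finiteT mu.
pose K k := [set v : n.+1.-tuple TR |
  F k (thead v) /\ G k [tuple of behead v]].
have KE k : @pcons n @^-1` K k = F k `*` G k.
  apply/seteqP; split => -[x v] /=; rewrite /K /pcons /= theadE.
    by move=> [Fx Gv]; split=> //; congr (G k _): Gv; exact/val_inj.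
  by move=> [Fx Gv]; split=> //; congr (G k _): Gv; exact/val_inj.
exists K.
  apply/seteqP; split=> // v _.
  have [i _ Fi] : (\bigcup_i F i) (thead v) by rewrite -FT.
  have [j _ Gj] : (\bigcup_i G i) [tuple of behead v] by rewrite -GT.
  exists (maxn i j) => //; split.
    by move: Fi; apply/subsetPset/ndF; rewrite leq_maxl.
  by move: Gj; apply/subsetPset/ndG; rewrite leq_maxr.
move=> k; have [mF Fk] := Foo k; have [mG Gk] := Goo k; split.
  apply: measurableI.
    rewrite -[X in measurable X]setTI.
    exact: (measurable_tnth ord0).
  rewrite -[X in measurable X]setTI.
  exact: (@measurable_behead _ TR n).
rewrite /lebesgue_tupleS /pushforward KE product_measure1E//.
by rewrite lte_mul_pinfty// ge0_fin_numE.
Qed.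

HB.instance Definition _ :=
  Measure_isSigmaFinite.Build _ _ _ lebesgue_tupleS lebesgue_tupleS_sigma_finite.

End lebesgue_tupleS.

Fixpoint lebesgue_tuple n : {sigma_finite_measure set (n.-tuple TR) -> \bar R} :=
  match n return {sigma_finite_measure set (n.-tuple TR) -> \bar R} with
  | 0 => dirac [tuple]
  | m.+1 => lebesgue_tupleS (lebesgue_tuple m)
  end.

End lebesgue_tuple.

Section hermite_kernel.
Context {R : realType}.
Local Notation TR := (measurableTypeR R).
Local Notation leb := (@lebesgue_measure R).

Definition beta_real (x y : R) : R :=
  \int[leb]_(u in `[0, 1]) (u `^ (x - 1) * (1 - u) `^ (y - 1)).

Definition pos_powR (theta r : R) : R := if 0 < theta then theta `^ r else 0.

Definition hermite_H0 (H : R) (q : nat) : R := 1 + (H - 1) / q%:R.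

Definition hermite_const (H : R) (q : nat) : R :=
  let H0 := hermite_H0 H q in
  Num.sqrt (H * (2 * H - 1) /
            (q`!%:R * beta_real (H0 - 1 / 2) (2 - 2 * H0) ^+ q)).

(* When q > 1 the integral diverges at some points with equal coordinates;
   there \int takes the value 0, on a null set. *)
Definition hermite_kernel (H : R) q (t : R) (xi : q.-tuple TR) : R :=
  hermite_const H q *
  \int[leb]_(s in `[0, t])
    \prod_(j < q) pos_powR (s - tnth xi j) (hermite_H0 H q - 3 / 2).

End hermite_kernel.
Arguments hermite_kernel {R} H q t xi.

Section hermite.
Context {d : measure_display} {Omega : measurableType d} {R : realType}.
Variable P : probability Omega R.
Local Notation TR := (measurableTypeR R).
Local Notation leb := (@lebesgue_measure R).
Implicit Types B Z X : R -> Omega -> R.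

Definition incr B (s t : R) : Omega -> R := fun w => B t w - B s w.

Record two_sided_brownian_motion B : Prop := {
  bm_measurable : forall t, measurable_fun setT (B t) ;
  bm_start : forall w, B 0 w = 0 ;
  bm_continuous : forall w, continuous (B ^~ w) ;
  bm_gaussian : forall s t, s < t -> forall A : set R, measurable A ->
    P (incr B s t @^-1` A) = normal_prob 0 (Num.sqrt (t - s)) A ;
  bm_independent : forall (n : nat) (t : nat -> R),
    (forall i, (i < n)%N -> t i < t i.+1) ->
    forall A : nat -> set R, (forall i, measurable (A i)) ->
    P (\bigcap_(i in `I_n) (incr B (t i) (t i.+1) @^-1` A i)) =
    (\prod_(i < n) P (incr B (t i) (t i.+1) @^-1` A i))%E }.

(* The classical two-sided Wiener space with its canonical process: w |-> B ^~ w
   identifies Omega with the continuous functions on R vanishing at 0, and every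
   event agrees, up to a null set, with one of the sigma-algebra generated by the
   coordinates (so Omega may carry that sigma-algebra or its completion). *)
Record wiener_space B : Prop := {
  ws_brownian : two_sided_brownian_motion B ;
  ws_canonical : forall f : R -> R, continuous f -> f 0 = 0 ->
    exists! w : Omega, forall t, B t w = f t ;
  ws_events : forall A : set Omega, measurable A ->
    exists2 A', <<s [set B t @^-1` Y | t in setT & Y in measurable] >> A' &
      P.-negligible (A `+` A') }.

(* Elementary integrands of the q-fold integral: linear combinations of
   indicators of ]t_(i 1), t_(i 1 + 1)] x ... x ]t_(i q), t_(i q + 1)] over a
   grid t_0 <= ... <= t_m, vanishing on the diagonals. *)
Record step_kernel q := StepKernel {
  sk_size : nat ;
  sk_grid : nat -> R ;
  sk_coef : {ffun 'I_q -> 'I_sk_size} -> R ;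
  sk_grid_nondecreasing : {homo sk_grid : i j / (i <= j)%N >-> i <= j} ;
  sk_off_diagonal : forall i : {ffun 'I_q -> 'I_sk_size},
    ~ injective i -> sk_coef i = 0 }.

Definition step_fun q (k : step_kernel q) (xi : q.-tuple TR) : R :=
  \sum_(i : {ffun 'I_q -> 'I_(sk_size k)}) sk_coef i *
    \prod_(j < q) \1_(`]sk_grid k (i j), sk_grid k (i j).+1]%classic)
      (tnth xi j).

Definition step_integral B q (k : step_kernel q) (w : Omega) : R :=
  \sum_(i : {ffun 'I_q -> 'I_(sk_size k)}) sk_coef i *
    \prod_(j < q) incr B (sk_grid k (i j)) (sk_grid k (i j).+1) w.

(* Y is a version of I_q(f): the integral is only defined almost surely, as the
   L^2(Omega)-limit of the integrals of any elementary integrands converging to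
   f in L^2(R^q). *)
Definition is_multiple_integral B q (f : q.-tuple TR -> R) (Y : Omega -> R) :=
  measurable_fun setT Y /\
  exists k : nat -> step_kernel q,
    Lnorm (lebesgue_tuple q) 2%:E (fun xi => (step_fun (k n) xi - f xi)%:E)
      @[n --> \oo] --> 0%E /\
    Lnorm P 2%:E (fun w => (step_integral B (k n) w - Y w)%:E)
      @[n --> \oo] --> 0%E.

Record hermite_process B (q : nat) (H : R) Z : Prop := {
  hermite_integral : forall t : R, 0 <= t ->
    is_multiple_integral B (hermite_kernel H q t) (Z t) ;
  hermite_start : forall w, Z 0 w = 0 ;
  hermite_holder : forall w (lambda : R), 0 < lambda -> lambda < H ->
    forall N : R, exists K : R, forall s t : R, s \in `[0, N] -> t \in `[0, N] ->
      `|Z t w - Z s w| <= K * `|t - s| `^ lambda }.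

Definition seasonal_mean (b0 b1 Tper t : R) : R :=
  b0 + b1 * sin (2 * pi * t / Tper).

Record pathwise_solution (T a sigma0 x0 : R) (b : R -> R) Z X : Prop := {
  sol_measurable : forall t : R, t \in `[0, T] -> measurable_fun setT (X t) ;
  sol_continuous : forall w, {within `[0, T], continuous (X ^~ w)} ;
  sol_equation : {ae P, forall w, forall t : R, t \in `[0, T] ->
    X t w =
      x0 + \int[leb]_(s in `[0, t]) (a * (b s - X s w)) + sigma0 * Z t w} }.

Definition path_sup (T : R) Z (w : Omega) : R :=
  sup [set `|Z s w| | s in `[0, T]].

Definition positivity_bound (T a p : R) Z (m sigma0 : R) : \bar R :=
  (1 - ((sigma0 * (2 + a * T) / m) `^ p)%:E *
       expectation P (fun w => path_sup T Z w `^ p)%R)%E.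

End hermite.

(* Main.v *)
Require Import Defs.
From mathcomp Require Import all_boot all_order all_algebra.
From mathcomp Require Import all_classical all_reals all_analysis.
From mathcomp Require Import measurable_realfun ring lra.
Import Order.TTheory GRing.Theory Num.Theory.
Import numFieldNormedType.Exports.
Local Open Scope classical_set_scope.
Local Open Scope ring_scope.
Set Implicit Arguments.
Unset Strict Implicit.
Unset Printing Implicit Defensive.

(** Two independent facts give the theorem: a pathwise comparison, and the
finiteness of all moments of C_T = sup |Z| over [0, T].

Comparison ([path_positive]). Suppose X vanishes or is negative at some t1, and
let t0 be the last time before t1 at which X >= m0. Such a time exists since
X 0 = x0 >= m0. On ]t0, t1] one has X < m0 <= b, so the drift a (b - X) is
nonnegative there and X t1 >= X t0 + sigma0 (Z t1 - Z t0) >= m0 - 2 sigma0 C_T.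
Hence 2 sigma0 C_T >= m0, and a fortiori sigma0 (2 + a T) C_T >= m0; Markov's
inequality for the p-th power of C_T bounds the probability of that event
([markov_powR]). The limit statement is then the fact that x ^ p <= x for x in
[0, 1].

Moments of C_T. An increment Z t - Z s is an L2-limit of differences of step
integrals. On a common refinement of the two grids such a difference is a
homogeneous multilinear polynomial of degree q in independent centred Gaussian
increments of B ([step_integral_refine]), and it satisfies a hypercontractive
bound: its moment of order 2m is at most a constant depending only on (q, m)
times the m-th power of its second moment. The bound is proved by induction on
the number of variables ([hypercontractive]): if F = h + x g with x independent
of (g, h) and symmetric, the odd powers of x drop out of E (h + x g)^(2m), and
the remaining terms are compared with the binomial expansion of
(E h^2 + E x^2 E g^2)^m. It passes to L2-limits by truncation
([l2_limit_hypercontractive]).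

Hypercontractivity also bounds the variances of the increments. The paths are
1/2-Hoelder, so that
(Z t - Z s) / sqrt |t - s| is pointwise bounded over the pairs (s, t); for a
family whose fourth moments are controlled by the squares of the second moments,
pointwise boundedness forces the variances to be bounded
([variance_bounded], a Paley-Zygmund argument). Therefore
E (Z t - Z s)^(2m) = O(|t - s|^m) for neighbouring points of the grids
T i / 16^n, and for m >= 3 Kolmogorov's chaining argument along these grids
([chaining], [grid_sup_moment_bounded]) yields E C_T^(2m) < oo. *)

(** * Random variables with moments of all orders *)

Section moments.
Context {d : measure_display} {T : measurableType d} {R : realType}.
Variable P : probability T R.
Local Notation "''EE' X" := (Rintegral P setT X) (at level 8, X at level 8).
Implicit Types X Y : T -> R.

(** The random variables with moments of all orders form an algebra; working in it
keeps integrability from being an issue for polynomials in Gaussian variables. *)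
Definition all_moments X :=
  measurable_fun setT X /\
  forall n, P.-integrable setT (EFin \o (fun w => X w ^+ n)).

Lemma all_moments_measurable X : all_moments X -> measurable_fun setT X.
Proof. by case. Qed.

Lemma all_moments_integrable X : all_moments X -> P.-integrable setT (EFin \o X).
Proof. by case=> _ /(_ 1%N); apply: eq_integrable. Qed.

Lemma all_moments_cst c : all_moments (cst c).
Proof. by split=> // n; exact: (finite_measure_integrable_cst P (c ^+ n)). Qed.

Lemma ler_powD (x y : R) n : `|(x + y) ^+ n| <= 2 ^+ n * (`|x ^+ n| + `|y ^+ n|).
Proof.
rewrite !normrX; have [xy|/ltW yx] := leP `|x| `|y|.
  have h : `|x + y| <= 2 * `|y| by rewrite (le_trans (ler_normD _ _))//; lra.
  rewrite (le_trans (lerXn2r n _ _ h)) ?nnegrE ?mulr_ge0// exprMn.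
  by rewrite ler_wpM2l ?exprn_ge0// lerDr exprn_ge0.
have h : `|x + y| <= 2 * `|x| by rewrite (le_trans (ler_normD _ _))//; lra.
rewrite (le_trans (lerXn2r n _ _ h)) ?nnegrE ?mulr_ge0// exprMn.
by rewrite ler_wpM2l ?exprn_ge0// lerDl exprn_ge0.
Qed.

Lemma all_momentsD X Y : all_moments X -> all_moments Y ->
  all_moments (fun w => X w + Y w).
Proof.
move=> [mX iX] [mY iY]; split=> [|n]; first exact: measurable_funD.
have iZ : P.-integrable setT (fun w =>
    ((2 ^+ n)%:E * ((`|X w ^+ n|)%:E + (`|Y w ^+ n|)%:E))%E).
  by apply: integrableZl => //; apply: integrableD => //; exact: integrable_norm.
apply: (le_integrable measurableT _ _ iZ) => //.
  by apply/measurable_EFinP; apply: measurable_funX; exact: measurable_funD.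
move=> w _ /=; rewrite lee_fin (le_trans (ler_powD _ _ _))//.
exact: ler_norm.
Qed.

Lemma ler_normM_sqr (x y : R) : `|x * y| <= `|x ^+ 2 + y ^+ 2|.
Proof.
rewrite normrM [leRHS]ger0_norm ?addr_ge0 ?sqr_ge0//.
rewrite -(real_normK (num_real x)) -(real_normK (num_real y)).
by have := sqr_ge0 (`|x| - `|y|); have := normr_ge0 x; have := normr_ge0 y; nra.
Qed.

Lemma all_momentsM X Y : all_moments X -> all_moments Y ->
  all_moments (fun w => X w * Y w).
Proof.
move=> [mX iX] [mY iY]; split=> [|n]; first exact: measurable_funM.
have iZ : P.-integrable setT (fun w =>
    ((X w ^+ (n * 2))%:E + (Y w ^+ (n * 2))%:E)%E).
  by apply: integrableD => //; [exact: iX | exact: iY].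
apply: (le_integrable measurableT _ _ iZ) => //.
  by apply/measurable_EFinP; apply: measurable_funX; exact: measurable_funM.
move=> w _ /=; rewrite lee_fin !exprM exprMn; exact: ler_normM_sqr.
Qed.

Lemma all_momentsX X n : all_moments X -> all_moments (fun w => X w ^+ n).
Proof.
move=> mX; elim: n => [|n ih]; first exact: (all_moments_cst 1).
rewrite (_ : (fun _ => _) = (fun w => X w * X w ^+ n)).
  exact: all_momentsM.
by apply/funext => w; rewrite exprS.
Qed.

Lemma all_momentsZ c X : all_moments X -> all_moments (fun w => c * X w).
Proof. exact/all_momentsM/all_moments_cst. Qed.

Lemma all_momentsB X Y : all_moments X -> all_moments Y ->
  all_moments (fun w => X w - Y w).
Proof.
move=> mX mY; under eq_fun do rewrite -mulN1r.
by apply: all_momentsD => //; exact: all_momentsZ.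
Qed.

Lemma all_moments_sum I (r : seq I) (F : I -> T -> R) :
  (forall i, all_moments (F i)) -> all_moments (fun w => \sum_(i <- r) F i w).
Proof.
move=> mF; elim: r => [|i r ih].
  by under eq_fun do rewrite big_nil; exact: (all_moments_cst 0).
by under eq_fun do rewrite big_cons; exact: all_momentsD.
Qed.

Lemma all_moments_prod I (r : seq I) (F : I -> T -> R) :
  (forall i, all_moments (F i)) -> all_moments (fun w => \prod_(i <- r) F i w).
Proof.
move=> mF; elim: r => [|i r ih].
  by under eq_fun do rewrite big_nil; exact: (all_moments_cst 1).
by under eq_fun do rewrite big_cons; exact: all_momentsM.
Qed.

Lemma all_moments_le X Y : measurable_fun setT X -> all_moments Y ->
  (forall w, `|X w| <= `|Y w|) -> all_moments X.
Proof.
move=> mX [mY iY] XY; split=> // n.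
apply: (le_integrable measurableT _ _ (iY n)) => //.
  by apply/measurable_EFinP; apply: measurable_funX.
by move=> w _ /=; rewrite lee_fin !normrX lerXn2r ?nnegrE.
Qed.

Lemma all_moments_indic (A : set T) : measurable A -> all_moments \1_A.
Proof.
move=> mA; apply: (all_moments_le (Y := cst 1)) => //.
  exact: all_moments_cst.
by move=> w; rewrite /= indicE; case: (_ \in _); rewrite ?normr1 ?normr0.
Qed.

Lemma expected_sum I (r : seq I) (F : I -> T -> R) :
  (forall i, all_moments (F i)) ->
  'EE (fun w => \sum_(i <- r) F i w) = \sum_(i <- r) 'EE (F i).
Proof.
move=> mF; elim: r => [|i r ih].
  rewrite big_nil; under eq_Rintegral do rewrite big_nil.
  by rewrite Rintegral_cst// mul0r.
rewrite big_cons -ih; under eq_Rintegral do rewrite big_cons.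
rewrite RintegralD//; first exact: all_moments_integrable.
by apply: all_moments_integrable; exact: all_moments_sum.
Qed.

Lemma expectedD X Y : all_moments X -> all_moments Y ->
  'EE (fun w => X w + Y w) = 'EE X + 'EE Y.
Proof. by move=> mX mY; rewrite RintegralD//; exact: all_moments_integrable. Qed.

Lemma expectedB X Y : all_moments X -> all_moments Y ->
  'EE (fun w => X w - Y w) = 'EE X - 'EE Y.
Proof. by move=> mX mY; rewrite RintegralB//; exact: all_moments_integrable. Qed.

Lemma expectedZ c X : all_moments X -> 'EE (fun w => c * X w) = c * 'EE X.
Proof. by move=> mX; rewrite RintegralZl//; exact: all_moments_integrable. Qed.

Lemma expected_le X Y : all_moments X -> all_moments Y ->
  (forall w, X w <= Y w) -> 'EE X <= 'EE Y.
Proof. by move=> mX mY XY; apply: le_Rintegral => //; exact: all_moments_integrable. Qed.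

Lemma expected_cst c : 'EE (cst c) = c.
Proof.
transitivity (c * fine (P setT)); first exact: Rintegral_cst.
by rewrite probability_setT mulr1.
Qed.

Lemma expected_indic (A : set T) : measurable A -> 'EE \1_A = fine (P A).
Proof. by move=> mA; rewrite /Rintegral integral_indic// setIT. Qed.

End moments.

(** * Independence and products of expectations *)

Section independence.
Context {d : measure_display} {T : measurableType d} {R : realType}.
Variable P : probability T R.
Local Notation "''EE' X" := (Rintegral P setT X) (at level 8, X at level 8).
Implicit Types (X Y W : T -> R) (A : set R).

Lemma expected_cvg (f_ : nat -> T -> R) (f g : T -> R) :
  (forall n, measurable_fun setT (f_ n)) -> measurable_fun setT f ->
  all_moments P g -> (forall n w, `|f_ n w| <= g w) ->
  (forall w, f_ n w @[n --> \oo] --> f w) -> 'EE (f_ n) @[n --> \oo] --> 'EE f.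
Proof.
move=> mf_ mf mg f_g f_f.
have [] := @dominated_convergence _ T R P setT measurableT
  (fun n => EFin \o f_ n) (EFin \o f) (EFin \o g).
- by move=> n; exact/measurable_EFinP.
- exact/measurable_EFinP.
- by apply: aeW => w _; apply: cvg_EFin (f_f w); exact: nearW.
- exact: all_moments_integrable.
- by apply: aeW => w n _; rewrite /= lee_fin.
- move=> iff _ cf.
  apply: fine_cvg; rewrite fineK//; exact: integrable_fin_num.
Qed.

(** Only the events {X \in A} enter this form of independence, so that the property is
linear in W and can be read off from the product rule for events. *)
Definition indep_of W X := forall A, measurable A ->
  'EE (fun w => W w * \1_A (X w)) = 'EE W * 'EE (fun w => \1_A (X w)).

Lemma indic_comp X A : (fun w => \1_A (X w)) = \1_(X @^-1` A) :> (T -> R).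
Proof. by apply/funext => w; rewrite !indicE. Qed.

Lemma all_moments_indic_comp X A : measurable_fun setT X -> measurable A ->
  all_moments P (fun w => \1_A (X w) : R).
Proof.
move=> mX mA; rewrite indic_comp; apply: all_moments_indic.
by rewrite -[X in measurable X]setTI; exact: mX.
Qed.

Import HBNNSimple.

Lemma indep_of_simple W X (g : {nnsfun R >-> R}) : all_moments P W ->
  measurable_fun setT X -> indep_of W X ->
  'EE (fun w => W w * g (X w)) = 'EE W * 'EE (fun w => g (X w)).
Proof.
move=> mW mX WX; have fin_g : finite_set (range g) by exact: fimfunP.
pose J y w : R := y * \1_(g @^-1` [set y]) (X w).
have gE w : g (X w) = \sum_(y <- finmap.enum_fset (fset_set (range g))) J y w.
  by rewrite fimfunE fsbig_finite.
have mJ y : all_moments P (J y).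
  by apply: all_momentsZ; exact: all_moments_indic_comp.
have -> : (fun w => g (X w)) = fun w =>
    \sum_(y <- finmap.enum_fset (fset_set (range g))) J y w.
  by apply/funext => w; rewrite gE.
under eq_Rintegral do rewrite gE mulr_sumr.
have mWJ y : all_moments P (fun w => W w * J y w) by exact: all_momentsM.
rewrite (@expected_sum _ _ _ P _ _ (fun y w => W w * J y w))//.
rewrite expected_sum// mulr_sumr; apply: eq_bigr => y _.
under eq_Rintegral do rewrite /J mulrCA.
have mA : measurable (g @^-1` [set y]) by [].
have amA : all_moments P (fun w => \1_(g @^-1` [set y]) (X w) : R).
  exact: all_moments_indic_comp.
rewrite (expectedZ y (all_momentsM mW amA)) (WX _ mA) (expectedZ y amA).
by rewrite mulrCA.
Qed.

(** Simple functions below phi increase to phi; along this approximation |W| phi(X)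
and phi(X) dominate the integrands of the two sides. *)
Lemma indep_of_nonneg W X (phi : R -> R) : all_moments P W ->
  measurable_fun setT X -> indep_of W X -> measurable_fun setT phi ->
  (forall x, 0 <= phi x) -> all_moments P (phi \o X) ->
  'EE (fun w => W w * phi (X w)) = 'EE W * 'EE (fun w => phi (X w)).
Proof.
move=> mW mX WX mphi phi0 amphi.
have mf : measurable_fun setT (EFin \o phi) by exact/measurable_EFinP.
pose g n := nnsfun_approx measurableT mf n.
have phi0' x : [set: R] x -> (0 <= (EFin \o phi) x)%E by rewrite lee_fin.
have g_le n x : g n x <= phi x.
  by rewrite -lee_fin /g nnsfun_approxE; exact: le_approx.
have g_cvg x : g n x @[n --> \oo] --> phi x.
  by have /fine_cvg := cvg_nnsfun_approx measurableT mf phi0' (I : [set: R] x).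
have mg n : measurable_fun setT (fun w => g n (X w)) by exact: measurableT_comp.
have amW : all_moments P (fun w => `|W w|).
  apply: (all_moments_le _ mW); last by move=> w; rewrite normr_id.
  by apply: measurableT_comp => //; exact: all_moments_measurable mW.
have c1 : 'EE (fun w => W w * g n (X w)) @[n --> \oo] -->
          'EE (fun w => W w * phi (X w)).
  apply: (@expected_cvg _ _ (fun w => `|W w| * phi (X w))).
  - by move=> n; apply: measurable_funM => //; exact: all_moments_measurable mW.
  - by apply: all_moments_measurable; exact: (all_momentsM mW amphi).
  - exact: (all_momentsM amW amphi).
  - by move=> n w; rewrite normrM ler_wpM2l// ger0_norm.
  - by move=> w; apply: cvgM; [exact: cvg_cst|exact: g_cvg].
have c2 : 'EE W * 'EE (fun w => g n (X w)) @[n --> \oo] -->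
          'EE W * 'EE (fun w => phi (X w)).
  apply: cvgM; first exact: cvg_cst.
  apply: (@expected_cvg _ _ (fun w => phi (X w))) => //.
  - exact: all_moments_measurable amphi.
  - by move=> n w; rewrite ger0_norm.
apply: (cvg_unique _ c1) => //.
have -> : (fun n => 'EE (fun w => W w * g n (X w))) =
          (fun n => 'EE W * 'EE (fun w => g n (X w))).
  by apply/funext => n; exact: indep_of_simple.
exact: c2.
Qed.

(** The signed case follows from the nonnegative one through
phi = |phi| - (|phi| - phi). *)
Lemma indep_of_comp W X (phi : R -> R) : all_moments P W ->
  measurable_fun setT X -> indep_of W X -> measurable_fun setT phi ->
  all_moments P (phi \o X) ->
  'EE (fun w => W w * phi (X w)) = 'EE W * 'EE (fun w => phi (X w)).
Proof.
move=> mW mX WX mphi amphi.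
have mn : measurable_fun setT (fun x => `|phi x|) by exact: measurableT_comp.
have mp : measurable_fun setT (fun x => `|phi x| - phi x) by exact: measurable_funB.
have am1 : all_moments P (fun w => `|phi (X w)|).
  apply: (all_moments_le _ amphi); last by move=> w; rewrite normr_id.
  by apply: measurableT_comp => //; exact: measurableT_comp.
have am2 : all_moments P (fun w => `|phi (X w)| - phi (X w)).
  exact: all_momentsB.
have e1 := @indep_of_nonneg W X (fun x => `|phi x|) mW mX WX mn
  (fun x => normr_ge0 _) am1.
have p2 x : 0 <= `|phi x| - phi x by rewrite subr_ge0 ler_norm.
have e2 := @indep_of_nonneg W X (fun x => `|phi x| - phi x) mW mX WX mp p2 am2.
have e3 (a : R) : phi a = `|phi a| - (`|phi a| - phi a) by ring.
have -> : (fun w => phi (X w)) =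
    (fun w => `|phi (X w)| - (`|phi (X w)| - phi (X w))).
  by apply/funext => w.
under eq_Rintegral do rewrite (e3 (X _)) mulrBr.
rewrite (expectedB (all_momentsM mW am1) (all_momentsM mW am2)).
by rewrite (expectedB am1 am2) e1 e2 mulrBr.
Qed.

End independence.

Section independent_family.
Context {d : measure_display} {T : measurableType d} {R : realType}.
Variable P : probability T R.
Local Notation "''EE' X" := (Rintegral P setT X) (at level 8, X at level 8).
Variables (n : nat) (xi : nat -> T -> R).
Hypothesis xi_moments : forall i, (i < n)%N -> all_moments P (xi i).
Hypothesis xi_indep : forall A : nat -> set R, (forall i, measurable (A i)) ->
  'EE (fun w => \prod_(i < n) \1_(A i) (xi i w)) =
  \prod_(i < n) 'EE (fun w => \1_(A i) (xi i w) : R).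

(** Indicators are replaced by functions of all-moments variables one variable at a
time: if the first N factors are already general, then by the induction hypothesis
the product W of the factors other than the N-th one is independent of xi N. *)
Let expected_prod_part (N : nat) (phi : nat -> R -> R) (A : nat -> set R) :
  (forall i, (i < n)%N -> measurable_fun setT (phi i)) ->
  (forall i, (i < n)%N -> all_moments P (fun w => phi i (xi i w))) ->
  (forall i, measurable (A i)) ->
  let psi i := if (i < N)%N then phi i else (\1_(A i) : R -> R) in
  'EE (fun w => \prod_(i < n) psi i (xi i w)) =
  \prod_(i < n) 'EE (fun w => psi i (xi i w)).
Proof.
move=> mphi aphi; elim: N A => [|N ih] A mA /=; first exact: xi_indep.
have [nN|Nn] := leqP n N.
  have e (i : 'I_n) : (i < N.+1)%N = (i < N)%N.
    by rewrite !(leq_trans (ltn_ord i))// leqW.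
  under eq_Rintegral do under eq_bigr do rewrite e.
  by under [RHS]eq_bigr do rewrite e; exact: ih.
have mxi (i : 'I_n) : measurable_fun setT (xi i).
  exact: all_moments_measurable (xi_moments (ltn_ord i)).
pose j := Ordinal Nn.
pose psi i : R -> R := if (i < N.+1)%N then phi i else \1_(A i).
pose W w := \prod_(i < n | i != j) psi i (xi i w).
have apsi (i : 'I_n) : all_moments P (fun w => psi i (xi i w)).
  rewrite /psi; case: ifP => _; first exact: aphi.
  exact: all_moments_indic_comp.
have aW : all_moments P W.
  rewrite /W; under eq_fun do rewrite big_mkcond.
  apply: all_moments_prod => i; case: (i != j) => //; exact: (all_moments_cst _ 1).
have WE B : measurable B ->
    'EE (fun w => W w * \1_B (xi j w)) =
    (\prod_(i < n | i != j) 'EE (fun w => psi i (xi i w))) *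
    'EE (fun w => \1_B (xi j w)).
  move=> mB; pose A' i := if i == N then B else A i.
  have mA' i : measurable (A' i) by rewrite /A'; case: ifP.
  pose psi' i : R -> R := if (i < N)%N then phi i else \1_(A' i).
  have psi'E (i : 'I_n) : i != j -> psi' i = psi i.
    move=> ij; have iN : (i == N :> nat) = false by exact/negbTE.
    have lt_iN : (i < N.+1)%N = (i < N)%N by rewrite ltnS leq_eqVlt iN.
    by rewrite /psi' /psi /A' lt_iN iN.
  have psi'j : psi' N = \1_B by rewrite /psi' ltnn /A' eqxx.
  transitivity ('EE (fun w => \prod_(i < n) psi' i (xi i w))).
    apply: eq_Rintegral => w _; rewrite (bigD1 j)//= psi'j mulrC; congr (_ * _).
    by apply: eq_bigr => i ij; rewrite psi'E.
  rewrite (ih _ mA' : _ = \prod_(i < n) 'EE (fun w => psi' i (xi i w))).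
  rewrite (bigD1 j)//= psi'j mulrC; congr (_ * _).
  by apply: eq_bigr => i ij; rewrite psi'E.
have EW : 'EE W = \prod_(i < n | i != j) 'EE (fun w => psi i (xi i w)).
  have := WE setT measurableT; rewrite indicT.
  under eq_Rintegral do rewrite mulr1.
  by rewrite (expected_cst P 1) mulr1.
have Wj : indep_of P W (xi j) by move=> B mB; rewrite WE// EW.
have psij : psi j = phi j by rewrite /psi /= ltnSn.
have -> : (fun w => \prod_(i < n) (if (i < N.+1)%N then phi i else \1_(A i)) (xi i w))
  = (fun w => W w * phi j (xi j w)).
  by apply/funext => w; rewrite (bigD1 j)//= ltnSn mulrC.
rewrite (indep_of_comp aW (mxi j) Wj (mphi _ Nn)); last exact: aphi.
by rewrite EW [RHS](bigD1 j)//= ltnSn mulrC.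
Qed.

Lemma expected_prod (N : nat) (phi : nat -> R -> R) : (N <= n)%N ->
  (forall i, (i < n)%N -> measurable_fun setT (phi i)) ->
  (forall i, (i < n)%N -> all_moments P (fun w => phi i (xi i w))) ->
  'EE (fun w => \prod_(i < N) phi i (xi i w)) =
  \prod_(i < N) 'EE (fun w => phi i (xi i w)).
Proof.
move=> Nn mphi aphi.
have := @expected_prod_part N phi (fun=> setT) mphi aphi (fun=> measurableT) => /= h.
under eq_Rintegral => w _.
  rewrite (big_ord_widen _ (fun i => phi i (xi i w)) Nn) big_mkcond/=.
  over.
rewrite (big_ord_widen _ (fun i => 'EE (fun w => phi i (xi i w))) Nn) big_mkcond/=.
transitivity ('EE (fun w => \prod_(i < n)
    (if (i < N)%N then phi i else (\1_setT : R -> R)) (xi i w))).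
  apply: eq_Rintegral => w _; apply: eq_bigr => i _.
  by case: ifP => // _; rewrite indicT.
rewrite h; apply: eq_bigr => i _; case: ifP => // _.
by rewrite indicT (expected_cst P 1).
Qed.

(** The span of the monomials: products of expectations need only be computed on
monomials, and linearity does the rest. *)
Definition polynomial_in N (W : T -> R) := exists r : seq (R * (nat -> nat)),
  W = fun w => \sum_(m <- r) m.1 * \prod_(i < N) xi i w ^+ m.2 i.

Lemma polynomial_in_cst N c : polynomial_in N (cst c).
Proof.
exists [:: (c, fun=> 0%N)]; apply/funext => w.
by rewrite big_seq1/= big1 ?mulr1.
Qed.

Lemma polynomial_inD N W1 W2 : polynomial_in N W1 -> polynomial_in N W2 ->
  polynomial_in N (fun w => W1 w + W2 w).
Proof.
move=> [r1 ->] [r2 ->]; exists (r1 ++ r2).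
by apply/funext => w; rewrite big_cat.
Qed.

Lemma polynomial_inM N W1 W2 : polynomial_in N W1 -> polynomial_in N W2 ->
  polynomial_in N (fun w => W1 w * W2 w).
Proof.
move=> [r1 ->] [r2 ->].
exists [seq (m1.1 * m2.1, fun i => (m1.2 i + m2.2 i)%N) | m1 <- r1, m2 <- r2].
apply/funext => w; rewrite big_allpairs_dep mulr_suml; apply: eq_bigr => m1 _.
rewrite mulr_sumr; apply: eq_bigr => m2 _ /=; rewrite mulrACA; congr (_ * _).
by rewrite -big_split/=; apply: eq_bigr => i _; rewrite exprD.
Qed.

Lemma polynomial_inX N W k : polynomial_in N W ->
  polynomial_in N (fun w => W w ^+ k).
Proof.
move=> pW; elim: k => [|k ih]; first exact: (polynomial_in_cst N 1).
by under eq_fun do rewrite exprS; exact: polynomial_inM.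
Qed.

Lemma polynomial_inS N W : polynomial_in N W -> polynomial_in N.+1 W.
Proof.
move=> [r ->]; exists [seq (m.1, fun i => if i == N then 0%N else m.2 i) | m <- r].
apply/funext => w; rewrite big_map; apply: eq_bigr => m _ /=; congr (_ * _).
rewrite big_ord_recr/= eqxx expr0 mulr1; apply: eq_bigr => i _.
by rewrite (ltn_eqF (ltn_ord i)).
Qed.

Lemma polynomial_in_var N : polynomial_in N.+1 (xi N).
Proof.
exists [:: (1, fun i => (i == N) : nat)]; apply/funext => w.
rewrite big_seq1 mul1r/= big_ord_recr/= eqxx expr1 big1 ?mul1r// => i _.
by rewrite (ltn_eqF (ltn_ord i)).
Qed.

Lemma polynomial_in_moments N W : (N <= n)%N -> polynomial_in N W -> all_moments P W.
Proof.
move=> Nn [r ->]; apply: all_moments_sum => m; apply: all_momentsZ.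
apply: all_moments_prod => i; apply: all_momentsX; apply: xi_moments.
exact: leq_trans (ltn_ord i) Nn.
Qed.

(** The only consequence of independence that the induction over the variables uses. *)
Lemma expected_polynomial_var N W k : (N < n)%N -> polynomial_in N W ->
  'EE (fun w => W w * xi N w ^+ k) = 'EE W * 'EE (fun w => xi N w ^+ k).
Proof.
move=> Nn [r ->].
have mono N' (e : nat -> nat) : (N' <= n)%N ->
    all_moments P (fun w => \prod_(i < N') xi i w ^+ e i).
  move=> N'n; apply: all_moments_prod => i; apply: all_momentsX; apply: xi_moments.
  exact: leq_trans (ltn_ord i) N'n.
have Emono N' (e : nat -> nat) : (N' <= n)%N ->
    'EE (fun w => \prod_(i < N') xi i w ^+ e i) =
    \prod_(i < N') 'EE (fun w => xi i w ^+ e i).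
  move=> N'n; apply: (@expected_prod N' (fun i x => x ^+ e i)) => //.
  by move=> i ni; apply: all_momentsX; exact: xi_moments.
pose e' (m : R * (nat -> nat)) i := if i == N then k else m.2 i.
have e'E w (m : R * (nat -> nat)) :
    \prod_(i < N) xi i w ^+ m.2 i = \prod_(i < N) xi i w ^+ e' m i.
  by apply: eq_bigr => i _; rewrite /e' (ltn_eqF (ltn_ord i)).
transitivity ('EE (fun w => \sum_(m <- r) m.1 * \prod_(i < N.+1) xi i w ^+ e' m i)).
  apply: eq_Rintegral => w _; rewrite mulr_suml; apply: eq_bigr => m _.
  by rewrite -mulrA e'E big_ord_recr/= {3}/e' eqxx.
rewrite expected_sum; last by move=> m; apply: all_momentsZ; exact: mono.
rewrite expected_sum; last by move=> m; apply: all_momentsZ; exact: mono (ltnW Nn).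
rewrite mulr_suml; apply: eq_bigr => m _.
rewrite (expectedZ _ (mono _ _ Nn)) (expectedZ _ (mono _ _ (ltnW Nn))).
rewrite !Emono// ?(ltnW Nn)// -mulrA big_ord_recr/= {2}/e' eqxx; congr (_ * (_ * _)).
by apply: eq_bigr => i _; rewrite /e' (ltn_eqF (ltn_ord i)).
Qed.

End independent_family.

(** * Hypercontractivity of multilinear polynomials *)

(** A crude form of Young's inequality; its lack of sharpness is absorbed in the
hypercontractivity constant. *)
Lemma ler_powM_mix {R : realType} (x y : R) (k m : nat) : 0 <= x -> 0 <= y ->
  (k <= m)%N -> x ^+ k * y ^+ (m - k) <= x ^+ m + y ^+ m.
Proof.
move=> x0 y0 km; have [xy|/ltW yx] := leP x y.
  apply: (@le_trans _ _ (y ^+ m)); last by rewrite lerDr exprn_ge0.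
  rewrite -{2}(subnKC km) exprD ler_wpM2r ?exprn_ge0//.
  by rewrite lerXn2r ?nnegrE.
apply: (@le_trans _ _ (x ^+ m)); last by rewrite lerDl exprn_ge0.
rewrite -{2}(subnKC km) exprD ler_wpM2l ?exprn_ge0//.
by rewrite lerXn2r ?nnegrE.
Qed.

Lemma sum_even_terms {R : realType} (f : nat -> R) m :
  \sum_(i < m.*2.+1) (if odd i then 0 else f i) = \sum_(k < m.+1) f k.*2.
Proof.
elim: m => [|m ih]; first by rewrite !big_ord_recr !big_ord0.
by rewrite doubleS 2!big_ord_recr [RHS]big_ord_recr/= ih odd_double/= addr0.
Qed.

Section hypercontractivity.
Context {d : measure_display} {T : measurableType d} {R : realType}.
Variable P : probability T R.
Local Notation "''EE' X" := (Rintegral P setT X) (at level 8, X at level 8).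
Variables (n : nat) (xi : nat -> T -> R) (M : nat -> R).
Hypothesis xi_moments : forall i, (i < n)%N -> all_moments P (xi i).
Hypothesis xi_indep : forall A : nat -> set R, (forall i, measurable (A i)) ->
  'EE (fun w => \prod_(i < n) \1_(A i) (xi i w)) =
  \prod_(i < n) 'EE (fun w => \1_(A i) (xi i w) : R).
Hypothesis xi_odd : forall i k, (i < n)%N -> odd k ->
  'EE (fun w => xi i w ^+ k) = 0.
Hypothesis xi_even : forall i k, (i < n)%N ->
  'EE (fun w => xi i w ^+ k.*2) <= M k * 'EE (fun w => xi i w ^+ 2) ^+ k.
Hypothesis M_ge0 : forall k, 0 <= M k.

(** Polynomials of degree at most q in xi 0, ..., xi (N - 1) that are affine in each
variable, in the recursive form h + xi (N - 1) g on which the induction of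
[hypercontractive] runs. *)
Fixpoint multilinear N q (F : T -> R) {struct N} : Prop :=
  match N, q with
  | 0, _ => exists c, F = cst c
  | N'.+1, 0 => multilinear N' 0 F
  | N'.+1, q'.+1 => exists g h, [/\ multilinear N' q' g, multilinear N' q'.+1 h &
      F = fun w => h w + xi N' w * g w]
  end.

Lemma multilinear_cst N q c : multilinear N q (cst c).
Proof.
elim: N q c => [|N ih] [|q] c /=; [by exists c|by exists c|exact: ih|].
exists (cst 0), (cst c); split=> //.
by apply/funext => w; rewrite /= mulr0 addr0.
Qed.

Lemma multilinearD N q F G : multilinear N q F -> multilinear N q G ->
  multilinear N q (fun w => F w + G w).
Proof.
elim: N q F G => [|N ih] [|q] F G /=.
- by move=> [a ->] [b ->]; exists (a + b).
- by move=> [a ->] [b ->]; exists (a + b).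
- exact: ih.
- move=> [g1 [h1 [mg1 mh1 ->]]] [g2 [h2 [mg2 mh2 ->]]].
  exists (fun w => g1 w + g2 w), (fun w => h1 w + h2 w).
  split; [exact: ih|exact: ih|].
  by apply/funext => w; ring.
Qed.

Lemma multilinearZ N q c F : multilinear N q F ->
  multilinear N q (fun w => c * F w).
Proof.
elim: N q F => [|N ih] [|q] F /=.
- by move=> [a ->]; exists (c * a).
- by move=> [a ->]; exists (c * a).
- exact: ih.
- move=> [g [h [mg mh ->]]]; exists (fun w => c * g w), (fun w => c * h w).
  split; [exact: ih|exact: ih|].
  by apply/funext => w; ring.
Qed.

Lemma multilinear_sum I (r : seq I) N q (F : I -> T -> R) :
  (forall i, multilinear N q (F i)) ->
  multilinear N q (fun w => \sum_(i <- r) F i w).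
Proof.
move=> mF; elim: r => [|i r ih].
  by under eq_fun do rewrite big_nil; exact: (multilinear_cst N q 0).
by under eq_fun do rewrite big_cons; exact: multilinearD.
Qed.

Lemma multilinear_prod N q (p : pred nat) : (\sum_(i < N) p i <= q)%N ->
  multilinear N q (fun w => \prod_(i < N | p i) xi i w).
Proof.
elim: N q => [|N ih] q.
  by exists 1; apply/funext => w; rewrite big_ord0.
rewrite big_ord_recr/=; case: q => [|q].
  rewrite leqn0 addn_eq0 => /andP[S0 pN]; rewrite eqb0 in pN.
  under eq_fun do rewrite big_mkcond big_ord_recr/= (negbTE pN) mulr1 -big_mkcond.
  by apply: ih; rewrite (eqP S0).
move=> Sq; case: (boolP (p N)) Sq => [pN|pN].
  rewrite addn1 ltnS => Sq.
  exists (fun w => \prod_(i < N | p i) xi i w), (cst 0); split.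
  - exact: ih.
  - exact: multilinear_cst.
  - apply/funext => w; rewrite big_mkcond big_ord_recr/= pN -big_mkcond/=.
    by rewrite add0r mulrC.
rewrite addn0 => Sq.
exists (cst 0), (fun w => \prod_(i < N | p i) xi i w); split.
- exact: multilinear_cst.
- exact: ih.
- apply/funext => w; rewrite big_mkcond big_ord_recr/= (negbTE pN) -big_mkcond/=.
  by rewrite mulr0 addr0 mulr1.
Qed.

Lemma multilinear_polynomial N q F : multilinear N q F -> polynomial_in xi N F.
Proof.
elim: N q F => [|N ih] [|q] F /=.
- by move=> [a ->]; exact: polynomial_in_cst.
- by move=> [a ->]; exact: polynomial_in_cst.
- by move=> /ih; exact: polynomial_inS.
- move=> [g [h [/ih pg /ih ph ->]]]; apply: polynomial_inD.
    exact: polynomial_inS.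
  by apply: polynomial_inM; [exact: polynomial_in_var|exact: polynomial_inS].
Qed.

(** Large enough for [hyper_constP], the comparison of coefficients that closes the
induction of [hypercontractive]. *)
Definition hyper_const m : R :=
  1 + \sum_(k < m.+1) 2 * 'C(m.*2, k.*2)%:R * M k.

Lemma hyper_const_ge1 m : 1 <= hyper_const m.
Proof. by rewrite lerDl sumr_ge0// => k _; rewrite !mulr_ge0. Qed.

Lemma hyper_constP m k : (0 < k <= m)%N ->
  2 * 'C(m.*2, k.*2)%:R * M k <= hyper_const m ^+ k * 'C(m, k)%:R.
Proof.
move=> /andP[k0 km]; have K1 := hyper_const_ge1 m.
apply: (@le_trans _ _ (hyper_const m)).
  rewrite /hyper_const (bigD1 (Ordinal (km : (k < m.+1)%N)))//=.
  rewrite addrCA lerDl addr_ge0// sumr_ge0// => i _.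
  by rewrite !mulr_ge0.
rewrite -[leLHS]mulr1 ler_pM ?ler1n ?bin_gt0//; first by rewrite (le_trans _ K1).
by rewrite -[leLHS]expr1 ler_weXn2l.
Qed.

Let moments N W : (N <= n)%N -> polynomial_in xi N W -> all_moments P W.
Proof. exact: polynomial_in_moments. Qed.

(** Binomial expansion in xi N; the odd powers of xi N have mean zero. *)
Let expected_pow_step N (g h : T -> R) m : (N < n)%N ->
  polynomial_in xi N g -> polynomial_in xi N h ->
  'EE (fun w => (h w + xi N w * g w) ^+ m.*2) =
  \sum_(k < m.+1) 'EE (fun w => g w ^+ k.*2 * h w ^+ (m - k).*2) *
    'EE (fun w => xi N w ^+ k.*2) *+ 'C(m.*2, k.*2).
Proof.
move=> Nn pg ph.
pose W i w := 'C(m.*2, i)%:R * (g w ^+ i * h w ^+ (m.*2 - i)).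
have pW i : polynomial_in xi N (W i).
  apply: polynomial_inM; first exact: polynomial_in_cst.
  by apply: polynomial_inM; exact: polynomial_inX.
have mW i : all_moments P (W i) by exact: moments (ltnW Nn) (pW i).
have mx i : all_moments P (fun w => xi N w ^+ i).
  by apply: all_momentsX; exact: xi_moments.
transitivity ('EE (fun w => \sum_(i < m.*2.+1) W i w * xi N w ^+ i)).
  apply: eq_Rintegral => w _; rewrite exprDn; apply: eq_bigr => i _.
  by rewrite /W exprMn -[LHS]mulr_natl; ring.
have -> := @expected_sum _ _ _ P _ (index_enum 'I_m.*2.+1)
  (fun i w => W i w * xi N w ^+ i) (fun i => all_momentsM (mW i) (mx i)).
transitivity (\sum_(i < m.*2.+1) (if odd i then 0 else
    'EE (fun w => g w ^+ i * h w ^+ (m.*2 - i)) * 'EE (fun w => xi N w ^+ i)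
    *+ 'C(m.*2, i))).
  apply: eq_bigr => i _.
  rewrite (expected_polynomial_var xi_moments xi_indep)//.
  case: ifP => oi; first by rewrite xi_odd// mulr0.
  rewrite /W expectedZ -?mulrA ?mulr_natl//; apply: moments (ltnW Nn) _.
  by apply: polynomial_inM; exact: polynomial_inX.
rewrite (sum_even_terms (fun i => 'EE (fun w => g w ^+ i * h w ^+ (m.*2 - i)) *
  'EE (fun w => xi N w ^+ i) *+ 'C(m.*2, i))).
by apply: eq_bigr => k _; rewrite doubleB.
Qed.

(** Strict inequality in the hypothesis leaves room for positive upper bounds A and B
of the second moments of g and h with E (xi N)^2 A + B = alpha, so that one can
divide by A and B even when these moments vanish. After normalisation the mixed
term of index k >= 1 is at most twice the product of the bounds, and K^k, gained
because g has degree one less than F, pays for this factor 2, for the binomial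
coefficient and for the moment of xi N. *)
Lemma hypercontractive m N q F : (N <= n)%N -> multilinear N q F ->
  forall alpha, 'EE (fun w => F w ^+ 2) < alpha ->
  'EE (fun w => F w ^+ m.*2) <= hyper_const m ^+ (q * m) * alpha ^+ m.
Proof.
set K := hyper_const m; have K1 : 1 <= K by exact: hyper_const_ge1.
have K0 : 0 < K by exact: lt_le_trans K1.
elim: N q F => [|N ih] q F Nn.
  move=> [c ->] alpha; rewrite (expected_cst P (c ^+ 2)) (expected_cst P (c ^+ m.*2)).
  move=> calpha; rewrite -mul2n exprM -[leLHS]mul1r ler_pM ?exprn_ege1//.
    by rewrite exprn_ge0// sqr_ge0.
  by rewrite lerXn2r ?nnegrE ?sqr_ge0// ltW// (le_lt_trans (sqr_ge0 c)).
case: q => [|q] /=; first exact: ih (ltnW Nn).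
move=> [g [h [mg mh ->]]] alpha.
have pg := multilinear_polynomial mg; have ph := multilinear_polynomial mh.
have amX k W : polynomial_in xi N W -> all_moments P (fun w => W w ^+ k).
  by move=> pW; apply: moments (ltnW Nn) _; exact: polynomial_inX.
set v := 'EE (fun w => xi N w ^+ 2).
set a := 'EE (fun w => g w ^+ 2); set b := 'EE (fun w => h w ^+ 2).
have v0 : 0 <= v by apply: Rintegral_ge0 => w _; exact: sqr_ge0.
have a0 : 0 <= a by apply: Rintegral_ge0 => w _; exact: sqr_ge0.
have b0 : 0 <= b by apply: Rintegral_ge0 => w _; exact: sqr_ge0.
have -> : 'EE (fun w => (h w + xi N w * g w) ^+ 2) = v * a + b.
  rewrite (@expected_pow_step N g h 1)// !big_ord_recr big_ord0/=.
  rewrite add0r !mulr1n.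
  under eq_Rintegral do rewrite mul1r.
  rewrite (expected_cst P 1) mulr1 addrC mulrC; congr (_ * _ + _).
  by apply: eq_Rintegral => w _; rewrite mulr1.
move=> vab.
(* eta is the slack that makes both bounds positive and the total equal to alpha. *)
pose eta := (alpha - (v * a + b)) / (v + 1).
have eta0 : 0 < eta by rewrite divr_gt0 ?subr_gt0// ltr_wpDl.
set A := a + eta; set B := b + eta.
have A0 : 0 < A by rewrite ltr_wpDl.
have B0 : 0 < B by rewrite ltr_wpDl.
have alphaE : alpha = B + v * A.
  by rewrite /A /B /eta; field; rewrite gt_eqF// ltr_wpDl.
have ihg := ih _ _ (ltnW Nn) mg A; rewrite ltrDl in ihg; have {}ihg := ihg eta0.
have ihh := ih _ _ (ltnW Nn) mh B; rewrite ltrDl in ihh; have {}ihh := ihh eta0.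
rewrite expected_pow_step// alphaE (exprDn B).
rewrite mulr_sumr; apply: ler_sum => k _.
have km : (k <= m)%N by rewrite -ltnS.
have [k0|k0] := posnP k.
  rewrite k0 !subn0 !bin0 !mulr1n mulr1.
  rewrite (expected_cst P 1) mulr1.
  by under eq_Rintegral do rewrite mul1r.
have [gam gamE] : exists gam, gam = K ^+ q * A by exists (K ^+ q * A).
have [del delE] : exists del, del = K ^+ q.+1 * B by exists (K ^+ q.+1 * B).
have gam0 : 0 < gam by rewrite gamE mulr_gt0// exprn_gt0.
have del0 : 0 < del by rewrite delE mulr_gt0// exprn_gt0.
have mix : 'EE (fun w => g w ^+ k.*2 * h w ^+ (m - k).*2) <=
    2 * (gam ^+ k * del ^+ (m - k)).
  apply: (@le_trans _ _ ('EE (fun w => gam ^+ k * del ^+ (m - k) *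
      (gam ^- m * g w ^+ m.*2 + del ^- m * h w ^+ m.*2)))).
    apply: expected_le.
    - by apply: all_momentsM; exact: amX.
    - apply: all_momentsZ; apply: all_momentsD; apply: all_momentsZ; exact: amX.
    - move=> w; rewrite -!mul2n !exprM.
      have := @ler_powM_mix R (g w ^+ 2 / gam) (h w ^+ 2 / del) k m.
      rewrite !divr_ge0 ?sqr_ge0 ?(ltW gam0) ?(ltW del0)// => /(_ isT isT km).
      rewrite !exprMn !exprVn => h1.
      have p0 : 0 < gam ^+ k * del ^+ (m - k) by rewrite mulr_gt0 ?exprn_gt0.
      rewrite -(ler_pM2l p0) in h1.
      apply: le_trans (le_trans _ h1) _; rewrite le_eqVlt; apply/orP; left;
        apply/eqP; first by field; rewrite !expf_neq0// ?gt_eqF.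
      by congr (_ * (_ + _)); rewrite mulrC.
  rewrite expectedZ; last by apply: all_momentsD; apply: all_momentsZ; exact: amX.
  rewrite mulrC ler_pM2r; last by rewrite mulr_gt0 ?exprn_gt0.
  rewrite expectedD; [|by apply: all_momentsZ; exact: amX..].
  rewrite !expectedZ; [|exact: amX..].
  have -> : 2 = 1 + 1 :> R by [].
  apply: lerD; rewrite mulrC ler_pdivrMr ?exprn_gt0// mul1r ?gamE ?delE.
    by rewrite exprMn -exprM.
  by rewrite exprMn -exprM.
rewrite -mulr_natr.
have x2 := xi_even k Nn; rewrite -/v in x2.
have x20 : 0 <= 'EE (fun w => xi N w ^+ k.*2).
  by apply: Rintegral_ge0 => w _; rewrite exprn_even_ge0// odd_double.
have g2h0 : 0 <= 'EE (fun w => g w ^+ k.*2 * h w ^+ (m - k).*2).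
  by apply: Rintegral_ge0 => w _; rewrite mulr_ge0// exprn_even_ge0// odd_double.
apply: (@le_trans _ _ (2 * (gam ^+ k * del ^+ (m - k)) * (M k * v ^+ k) *
    'C(m.*2, k.*2)%:R)).
  by rewrite ler_wpM2r// ler_pM.
have -> : 2 * (gam ^+ k * del ^+ (m - k)) * (M k * v ^+ k) * 'C(m.*2, k.*2)%:R =
    (2 * 'C(m.*2, k.*2)%:R * M k) * (gam ^+ k * del ^+ (m - k) * v ^+ k) by ring.
apply: (@le_trans _ _ (K ^+ k * 'C(m, k)%:R * (gam ^+ k * del ^+ (m - k) * v ^+ k))).
  rewrite ler_wpM2r ?mulr_ge0 ?exprn_ge0 ?(ltW gam0) ?(ltW del0)//.
  by apply: hyper_constP; rewrite k0.
rewrite le_eqVlt; apply/orP; left; apply/eqP.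
rewrite gamE delE -[in RHS]mulr_natr !exprMn -!exprM.
have -> : (q.+1 * m = k + q * k + q.+1 * (m - k))%N.
  by rewrite -mulSn -mulnDr subnKC.
by rewrite !exprD; ring.
Qed.

End hypercontractivity.

(** * Moments of centred Gaussian variables *)

Section normal_moments.
Context {R : realType}.
Local Notation leb := (@lebesgue_measure R).

(** The normal density is a version of the Radon-Nikodym derivative. *)
Lemma integral_normal_prob (m s : R) (f : R -> \bar R) :
  measurable_fun setT f -> (forall x, 0 <= f x)%E ->
  (\int[normal_prob m s]_x f x = \int[leb]_x (f x * (normal_pdf m s x)%:E))%E.
Proof.
move=> mf f0; have dom := normal_prob_dominates m s.
rewrite -(Radon_Nikodym_SigmaFinite.change_of_variables dom)//=.
have ip := integrable_normal_pdf m s.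
apply: ae_eq_integral => //.
- apply: emeasurable_funM => //; apply: (measurable_int leb).
  exact: Radon_Nikodym_SigmaFinite.f_integrable.
- by apply: emeasurable_funM => //; exact: measurable_int ip.
- apply: ae_eqe_mul2l; apply: integral_ae_eq => //.
  + exact: Radon_Nikodym_SigmaFinite.f_integrable.
  + exact: measurable_int ip.
  + by move=> A _ mA; rewrite -Radon_Nikodym_SigmaFinite.f_integral.
Qed.

(** Both the density and Lebesgue measure are even. *)
Lemma normal_probN (s : R) (A : set R) : s != 0 -> measurable A ->
  normal_prob 0 s (-%R @^-1` A) = normal_prob 0 s A.
Proof.
move=> s0 mA; rewrite /normal_prob.
have mpdf : measurable_fun setT (fun x => (normal_pdf 0 s x)%:E).
  by apply/measurable_EFinP; exact: measurable_normal_pdf.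
have pdfN x : normal_pdf 0 s x = normal_pdf 0 s (- x).
  by rewrite !normal_pdfE// /normal_fun !subr0 sqrrN.
rewrite -[RHS](@eq_measure_integral _ (measurableTypeR R) R A leb
  (pushforward leb (-%R : _ -> measurableTypeR R))); last first.
  by move=> B mB _; first [exact: lebesgue_measureN|exact/esym/lebesgue_measureN].
rewrite ge0_integral_pushforward.
- by apply: eq_integral => x _ /=; rewrite pdfN.
- exact: oppr_measurable.
- exact: mA.
- exact: measurable_funTS mpdf.
- by move=> x _; rewrite lee_fin normal_pdf_ge0.
Qed.

(** Completing the square: exp(t x) times the density of N(0, s^2) is a multiple of
the density of N(t s^2, s^2). *)
Lemma normal_mgf (s t : R) : s != 0 ->
  (\int[normal_prob 0 s]_x (expR (t * x))%:E = (expR (t ^+ 2 * s ^+ 2 / 2))%:E)%E.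
Proof.
move=> s0.
have mf : measurable_fun setT (fun x : R => (expR (t * x))%:E).
  by apply/measurable_EFinP; apply: measurableT_comp => //; exact: measurable_funM.
rewrite integral_normal_prob//.
transitivity (\int[leb]_x ((expR (t ^+ 2 * s ^+ 2 / 2))%:E *
    (normal_pdf (t * s ^+ 2) s x)%:E))%E.
  apply: eq_integral => x _; rewrite -!EFinM; congr EFin.
  rewrite !normal_pdfE// !(mulrCA _ (normal_peak s)); congr (_ * _).
  by rewrite /normal_fun -!expRD; congr expR; field.
rewrite integralZl//; last exact: integrable_normal_pdf.
by rewrite integral_normal_pdf mule1.
Qed.

Lemma normal_peak_le (s : R) : 0 < s -> normal_peak s <= s^-1 / 2.
Proof.
move=> s0; rewrite /normal_peak -invfM lef_pV2 ?posrE ?mulr_gt0//; last first.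
  by rewrite sqrtr_gt0 pmulrn_rgt0// mulr_gt0 ?exprn_gt0 ?pi_gt0.
have -> : s * 2 = Num.sqrt ((s * 2) ^+ 2).
  by rewrite sqrtr_sqr ger0_norm// mulr_ge0// ltW.
apply: ler_wsqrtr.
by have := @pi_ge2 R; have := exprn_gt0 2 s0; nra.
Qed.

(** The density is at most 1 / (2 s) because pi >= 2. This anticoncentration bounds
the variance from below. *)
Lemma normal_prob_center_le (s : R) : 0 < s ->
  (normal_prob 0 s `[(- (s / 2))%R, (s / 2)%R] <= (1 / 2)%:E)%E.
Proof.
move=> s0; have s0' : s != 0 by rewrite gt_eqF.
rewrite /normal_prob.
apply: (@le_trans _ _ (\int[leb]_(x in `[(- (s / 2))%R, (s / 2)%R]) (s^-1 / 2)%:E)%E).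
  apply: ge0_le_integral => //=.
  - by move=> x _; rewrite lee_fin normal_pdf_ge0.
  - by apply/measurable_EFinP; apply: measurable_funTS; exact: measurable_normal_pdf.
  - move=> x _; rewrite lee_fin (le_trans (normal_pdf_ub 0 x s0'))//.
    exact: normal_peak_le.
rewrite integral_cst//= lebesgue_measure_itv/= lte_fin.
rewrite ifT; last by rewrite gtrN// divr_gt0.
rewrite -EFinB -EFinM lee_fin le_eqVlt; apply/orP; left; apply/eqP.
by field.
Qed.

End normal_moments.

(** The constant comes from x^(2k) / s^(2k) <= (2k)! (exp(x / s) + exp(- x / s)), where
each exponential has mean exp(1 / 2), and from s^2 <= 8 E xi^2. *)
Definition normal_moment_const {R : realType} (k : nat) : R :=
  2 * (k.*2)`!%:R * expR (1 / 2) * 8 ^+ k.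

Section normal_variable.
Context {d : measure_display} {T : measurableType d} {R : realType}.
Variable P : probability T R.
Local Notation "''EE' X" := (Rintegral P setT X) (at level 8, X at level 8).
Variables (s : R) (xi : T -> R).
Hypothesis s0 : 0 < s.
Hypothesis mxi : measurable_fun setT xi.
Hypothesis xi_normal : forall A : set R, measurable A ->
  P (xi @^-1` A) = normal_prob 0 s A.

Let integral_xi (f : R -> \bar R) : measurable_fun setT f ->
  (forall x, 0 <= f x)%E ->
  (\int[P]_w f (xi w) = \int[normal_prob 0 s]_x f x)%E.
Proof.
move=> mf f0.
have mxi' : measurable_fun setT (xi : T -> measurableTypeR R) by exact: mxi.
have mf' : measurable_fun setT (f : measurableTypeR R -> \bar R) by exact: mf.
have <- := ge0_integral_pushforward mxi' P measurableT mf' (fun x _ => f0 x).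
by apply: eq_measure_integral => A mA _; exact: xi_normal.
Qed.

Let expR_pow_le (x : R) n : `|x ^+ n| <= n`!%:R * s ^+ n *
  (expR (s^-1 * x) + expR (- s^-1 * x)).
Proof.
have e1 : (`|x| / s) ^+ n / n`!%:R <= expR (s^-1 * x) + expR (- s^-1 * x).
  apply: (@le_trans _ _ (expR (`|x| / s))).
    have y0 : 0 <= `|x| / s by rewrite divr_ge0// ltW.
    case: n => [|n]; first by rewrite expr0 fact0 divr1 -expR0 ler_expR.
    by rewrite (le_trans _ (expR_ge1Dxn n y0))// lerDr.
  rewrite mulrC; have [x0|x0] := ger0P x.
    by rewrite lerDl expR_ge0.
  by rewrite mulrN mulNr lerDr expR_ge0.
have f0 : 0 < n`!%:R * s ^+ n :> R by rewrite mulr_gt0 ?exprn_gt0// ltr0n fact_gt0.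
rewrite -(ler_pM2l f0) in e1; apply: le_trans e1.
rewrite normrX exprMn exprVn le_eqVlt; apply/orP; left; apply/eqP; field.
by rewrite expf_neq0 ?gt_eqF// ltr0n fact_gt0.
Qed.

Let xi_abs_moment n : (\int[P]_w (`|xi w ^+ n|)%:E <=
  (2 * n`!%:R * expR (1 / 2) * s ^+ n)%:E)%E.
Proof.
have me (a : R) : measurable_fun setT (fun x : R => expR (a * x)).
  by apply: measurableT_comp => //; exact: measurable_funM.
have mgf (a : R) : a ^+ 2 = s ^- 2 ->
    (\int[P]_w (expR (a * xi w))%:E = (expR (1 / 2))%:E)%E.
  move=> a2; rewrite (integral_xi (f := fun x => (expR (a * x))%:E)).
  - by rewrite normal_mgf ?gt_eqF// a2 mulVf// expf_neq0// gt_eqF.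
  - exact/measurable_EFinP.
  - by move=> x; rewrite lee_fin expR_ge0.
apply: (@le_trans _ _ (\int[P]_w ((n`!%:R * s ^+ n)%:E *
    ((expR (s^-1 * xi w))%:E + (expR (- s^-1 * xi w))%:E)))%E).
  apply: ge0_le_integral => //.
  - by apply/measurable_EFinP; apply: measurableT_comp => //; exact: measurable_funX.
  - apply: emeasurable_funM => //; apply: emeasurable_funD; apply/measurable_EFinP;
      exact: measurableT_comp (me _) mxi.
  - by move=> w _; rewrite -EFinD -EFinM lee_fin expR_pow_le.
have mex (a : R) : measurable_fun setT (fun w => (expR (a * xi w))%:E).
  by apply/measurable_EFinP; exact: measurableT_comp (me _) mxi.
have pos : 0 <= n`!%:R * s ^+ n by rewrite mulr_ge0// exprn_ge0// ltW.
rewrite ge0_integralZl_EFin//; last 2 first.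
- by move=> w _; rewrite adde_ge0// lee_fin expR_ge0.
- exact: emeasurable_funD.
rewrite ge0_integralD//; [|by move=> w _; rewrite lee_fin expR_ge0..].
rewrite !mgf ?sqrrN ?exprVn// -EFinD -EFinM lee_fin.
by rewrite le_eqVlt; apply/orP; left; apply/eqP; ring.
Qed.

Lemma normal_all_moments : all_moments P xi.
Proof.
split=> // n; apply/integrableP; split.
  by apply/measurable_EFinP; exact: measurable_funX.
by rewrite (le_lt_trans (xi_abs_moment n))// ltry.
Qed.

Lemma normal_odd_moment k : odd k -> 'EE (fun w => xi w ^+ k) = 0.
Proof.
move=> ok; have s0' : s != 0 by rewrite gt_eqF.
have mX : measurable_fun setT (fun x : R => (x ^+ k)%:E).
  by apply/measurable_EFinP; exact: measurable_funX.
have iX : P.-integrable setT ((fun x : R => (x ^+ k)%:E) \o xi).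
  exact: normal_all_moments.2.
have mNxi : measurable_fun setT (fun w => - xi w) by exact: measurableT_comp.
have iNX : P.-integrable setT ((fun x : R => (x ^+ k)%:E) \o (fun w => - xi w)).
  apply: eq_integrable (integrableZl measurableT (-1) iX) => // w _ /=.
  by rewrite exprNn -signr_odd ok expr1 mulN1r mulN1e.
have e : (\int[P]_w (xi w ^+ k)%:E = \int[P]_w ((- xi w) ^+ k)%R%:E)%E.
  have mxi' : measurable_fun setT (xi : T -> measurableTypeR R) by exact: mxi.
  have mNxi' : measurable_fun setT ((fun w => - xi w) : T -> measurableTypeR R).
    exact: mNxi.
  have mX' : measurable_fun setT (fun x : measurableTypeR R => (x ^+ k)%:E).
    exact: mX.
  have <- := integral_pushforward mxi' mX' iX measurableT.
  have <- := integral_pushforward mNxi' mX' iNX measurableT.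
  apply: eq_measure_integral => A mA _; rewrite /pushforward.
  rewrite [LHS]xi_normal// -normal_probN// -xi_normal//.
  rewrite -[X in measurable X]setTI.
  by have : measurable_fun setT (-%R : R -> R) by []; exact.
have {}e : 'EE (fun w => xi w ^+ k) = - 'EE (fun w => xi w ^+ k).
  rewrite {1}/Rintegral e -[RHS]mulN1r -expectedZ; last first.
    exact/all_momentsX/normal_all_moments.
  by congr fine; apply: eq_integral => w _; rewrite exprNn -signr_odd ok expr1.
by apply/eqP; rewrite -[_ == 0](mulrn_eq0 _ 2) mulr2n {1}e addNr.
Qed.

(** The variable exceeds s / 2 in absolute value with probability at least 1 / 2. *)
Let variance_ge : s ^+ 2 <= 8 * 'EE (fun w => xi w ^+ 2).
Proof.
pose A := xi @^-1` `[(- (s / 2)), (s / 2)]%classic.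
have mA : measurable A by rewrite -[A]setTI; exact: mxi.
have PA : 'EE \1_A <= 1 / 2.
  rewrite expected_indic//= -lee_fin fineK ?fin_num_measure//.
  by rewrite xi_normal//; exact: normal_prob_center_le.
have am1 : all_moments P (cst 1 : T -> R) := all_moments_cst P 1.
have amA : all_moments P (\1_A : T -> R) by exact: all_moments_indic.
have amx : all_moments P (fun w => xi w ^+ 2).
  exact/all_momentsX/normal_all_moments.
have := @expected_le _ _ _ P (fun w => (s / 2) ^+ 2 * (cst 1 w - \1_A w))
  (fun w => xi w ^+ 2) (all_momentsZ _ (all_momentsB am1 amA)) amx.
rewrite expectedZ; last exact: all_momentsB.
rewrite (expectedB am1 amA) (expected_cst P 1).
move=> h; have {}h : (s / 2) ^+ 2 * (1 - 'EE \1_A) <= 'EE (fun w => xi w ^+ 2).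
  apply: h => w; rewrite indicE /cst; have [wA|wA] := boolP (w \in A).
    by rewrite subrr mulr0 sqr_ge0.
  rewrite subr0 mulr1 -[leRHS]real_normK ?num_real//.
  rewrite lerXn2r ?nnegrE// ?divr_ge0 ?ltW// ltNge; apply: contra wA => xs.
  by rewrite inE /A/= in_itv/= -ler_norml.
by have := exprn_gt0 2 s0; nra.
Qed.

Lemma normal_even_moment k :
  'EE (fun w => xi w ^+ k.*2) <=
  normal_moment_const k * 'EE (fun w => xi w ^+ 2) ^+ k.
Proof.
apply: (@le_trans _ _ (2 * (k.*2)`!%:R * expR (1 / 2) * s ^+ k.*2)).
  have am := all_momentsX k.*2 normal_all_moments.
  rewrite -lee_fin fineK; last first.
    exact: integrable_fin_num (all_moments_integrable am).
  apply: le_trans (xi_abs_moment _); rewrite le_eqVlt; apply/orP; left; apply/eqP.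
  apply: eq_integral => w _; rewrite ger0_norm// exprn_even_ge0// odd_double//.
rewrite /normal_moment_const -[leRHS]mulrA ler_wpM2l//.
rewrite -exprMn -mul2n exprM lerXn2r ?nnegrE ?sqr_ge0//.
by rewrite (le_trans _ variance_ge)// sqr_ge0.
Qed.

End normal_variable.

(** * Step integrals as multilinear polynomials of Brownian increments *)

Section brownian_grid.
Context {d : measure_display} {Omega : measurableType d} {R : realType}.
Variables (P : probability Omega R) (B : R -> Omega -> R).
Hypothesis hB : two_sided_brownian_motion P B.
Local Notation "''EE' X" := (Rintegral P setT X) (at level 8, X at level 8).
Variables (n : nat) (t : nat -> R).
Hypothesis t_inc : forall i, (i < n)%N -> t i < t i.+1.

Let xi i := incr B (t i) (t i.+1).

Let mincr a b : measurable_fun setT (incr B a b).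
Proof. by apply: measurable_funB; exact: bm_measurable hB _. Qed.

Let sqrt_gt0 i : (i < n)%N -> 0 < Num.sqrt (t i.+1 - t i).
Proof. by move=> ni; rewrite sqrtr_gt0 subr_gt0 t_inc. Qed.

Let xi_normal i : (i < n)%N -> forall A : set R, measurable A ->
  P (xi i @^-1` A) = normal_prob 0 (Num.sqrt (t i.+1 - t i)) A.
Proof. by move=> ni A mA; exact: bm_gaussian hB _ _ (t_inc ni) _ mA. Qed.

Lemma increments_moments i : (i < n)%N -> all_moments P (xi i).
Proof.
by move=> ni; exact: normal_all_moments (sqrt_gt0 ni) (mincr _ _) (xi_normal ni).
Qed.

Lemma increments_odd i k : (i < n)%N -> odd k -> 'EE (fun w => xi i w ^+ k) = 0.
Proof.
by move=> ni; exact: normal_odd_moment (sqrt_gt0 ni) (mincr _ _) (xi_normal ni) _.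
Qed.

Lemma increments_even i k : (i < n)%N ->
  'EE (fun w => xi i w ^+ k.*2) <=
  normal_moment_const k * 'EE (fun w => xi i w ^+ 2) ^+ k.
Proof.
by move=> ni; exact: normal_even_moment (sqrt_gt0 ni) (mincr _ _) (xi_normal ni) _.
Qed.

Lemma increments_indep (A : nat -> set R) : (forall i, measurable (A i)) ->
  'EE (fun w => \prod_(i < n) \1_(A i) (xi i w)) =
  \prod_(i < n) 'EE (fun w => \1_(A i) (xi i w) : R).
Proof.
move=> mA.
have mxA i : measurable (xi i @^-1` A i).
  by rewrite -[X in measurable X]setTI; exact: mincr.
have -> : (fun w => \prod_(i < n) \1_(A i) (xi i w)) =
    \1_(\bigcap_(i in `I_n) (xi i @^-1` A i)) :> (Omega -> R).
  apply/funext => w; rewrite indicE.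
  have [|/negP] := boolP (w \in _).
    rewrite inE => wA; rewrite big1// => i _; rewrite indicE mem_set//.
    by apply: wA => /=.
  rewrite inE => /existsNP[i /not_implyP[/= ni wA]].
  by rewrite (bigD1 (Ordinal ni))//= indicE memNset// mul0r.
rewrite expected_indic; last by apply: fin_bigcap_measurable => // i _.
rewrite (bm_independent hB t_inc mA).
have -> : (\prod_(i < n) P (xi i @^-1` A i) =
    (\prod_(i < n) fine (P (xi i @^-1` A i)))%:E)%E.
  elim/big_ind2 : _ => // [_ x _ y -> ->//|i _].
  by rewrite fineK// fin_num_measure.
by apply: eq_bigr => i _; rewrite indic_comp expected_indic.
Qed.

End brownian_grid.

Lemma prod_in_image {R : comNzRingType} (q n : nat) (f : {ffun 'I_q -> 'I_n})
    (x : nat -> R) : injective f ->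
  \prod_(j < q) x (f j) = \prod_(i < n | [exists j, f j == i :> nat]) x i.
Proof.
move=> fi; rewrite -(big_imset (fun i : 'I_n => x i) (in2W fi) : _ = \prod_(j < q) _).
apply: eq_bigl => i; apply/imsetP/existsP => [[j _ ->]|[j /eqP ji]].
  by exists j.
by exists j => //; exact/val_inj.
Qed.

Lemma card_in_image (q n : nat) (f : {ffun 'I_q -> 'I_n}) : injective f ->
  (\sum_(i < n) [exists j, f j == i :> nat] = q)%N.
Proof.
move=> fi; rewrite -big_mkcond sum1_card -[RHS]card_ord -(card_codom fi).
apply: eq_card => i; rewrite unfold_in; apply/existsP/codomP => [[j /eqP ji]|[j ->]].
  by exists j; exact/val_inj.
by exists j.
Qed.

Section refinement.
Context {d : measure_display} {Omega : measurableType d} {R : realType}.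
Variables (B : R -> Omega -> R) (q : nat) (k : @step_kernel R q) (s : seq R).
Hypothesis s_sorted : sorted <%R s.
Hypothesis k_s : forall i, (i <= sk_size k)%N -> sk_grid k i \in s.
Let t i := nth 0 s i.
Let n := (size s).-1.
Let xi i := incr B (t i) (t i.+1).

Let pos i := index (sk_grid k i) s.

Let pos_le i j : (i <= j <= sk_size k)%N -> (pos i <= pos j)%N.
Proof.
move=> /andP[ij jk]; rewrite leqNgt; apply/negP => ji.
have := sorted_ltn_index lt_trans s_sorted _ _ (k_s jk) (k_s (leq_trans ij jk)) ji.
by rewrite ltNge sk_grid_nondecreasing.
Qed.

Let inside i (l : nat) : bool := (pos i <= l < pos i.+1)%N.

Let incr_refine i w : (i < sk_size k)%N ->
  incr B (sk_grid k i) (sk_grid k i.+1) w = \sum_(l < n) (inside i l)%:R * xi l w.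
Proof.
move=> ik; have ks1 := k_s ik; have ks0 := k_s (ltnW ik).
have pn : (pos i.+1 <= n)%N.
  by rewrite /n -ltnS prednK ?index_mem//; case: (s) ks0.
have -> : incr B (sk_grid k i) (sk_grid k i.+1) w =
    B (t (pos i.+1)) w - B (t (pos i)) w by rewrite /t !nth_index.
rewrite -(telescope_sumr (fun l => B (t l) w)); last by rewrite pos_le// leqnSn.
rewrite (big_nat_widen _ _ n)//= (big_nat_widenl _ 0%N)//= big_mkord big_mkcond/=.
apply: eq_bigr => l _; rewrite /inside andbC.
by case: ifP => _; rewrite ?mul1r ?mul0r.
Qed.

(** Each increment over the coarse grid telescopes into increments over s; expanding
the product of these sums gives the coefficients. Two equal fine intervals lie in
the same coarse one, where the coefficient of k vanishes: the diagonals remain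
excluded after refinement. *)
Lemma step_integral_refine : exists c : {ffun 'I_q -> 'I_n} -> R,
  (forall l : {ffun 'I_q -> 'I_n}, ~ injective l -> c l = 0) /\
  (forall w, step_integral B k w = \sum_l c l * \prod_(j < q) xi (l j) w).
Proof.
exists (fun l : {ffun 'I_q -> 'I_n} => \sum_(i : {ffun 'I_q -> 'I_(sk_size k)}) sk_coef i *
  \prod_(j < q) (inside (i j) (l j))%:R); split=> [l l_ninj|w].
  rewrite big1// => i _.
  have [/injectiveP i_inj|/injectiveP i_ninj] := boolP (injectiveb i); last first.
    by rewrite sk_off_diagonal// mul0r.
  have [j [j' [ll jj']]] : exists j j', l j = l j' /\ j != j'.
    apply: contrapT => h; apply: l_ninj => j j' ll; apply/eqP/negP => jj'.
    by apply: h; exists j, j'; split=> //; apply/negP.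
  wlog ii' : j j' ll jj' / (i j < i j')%N.
    move=> h; have [|/h|ii'] := ltngtP (i j) (i j'); first exact: h.
      by apply=> //; rewrite eq_sym.
    by move/negP: jj'; case; apply/eqP/i_inj/val_inj.
  rewrite (bigD1 j)//= (bigD1 j')//=; last by rewrite eq_sym.
  suff : ~~ (inside (i j) (l j) && inside (i j') (l j)).
    rewrite -ll; case: inside => //=; last by rewrite !(mul0r, mulr0).
    by case: inside => //=; rewrite !(mul0r, mulr0).
  apply/negP => /andP[/andP[_ h1] /andP[h2 _]].
  have : (pos (i j).+1 <= pos (i j'))%N by apply: pos_le; rewrite ii'/= ltnW.
  by move=> h3; have := leq_trans (leq_trans h1 h3) h2; rewrite ltnn.
rewrite /step_integral.
under [RHS]eq_bigr do rewrite mulr_suml.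
rewrite [RHS]exchange_big/=; apply: eq_bigr => i _.
under eq_bigr do rewrite incr_refine//.
rewrite bigA_distr_bigA mulr_sumr; apply: eq_bigr => l _.
by rewrite -mulrA -big_split.
Qed.

End refinement.

Section step_hypercontractivity.
Context {d : measure_display} {Omega : measurableType d} {R : realType}.
Variables (P : probability Omega R) (B : R -> Omega -> R).
Hypothesis hB : two_sided_brownian_motion P B.
Local Notation "''EE' X" := (Rintegral P setT X) (at level 8, X at level 8).

Definition chaos_const q m : R := hyper_const normal_moment_const m ^+ (q * m).

Lemma chaos_const_ge1 q m : 1 <= chaos_const q m.
Proof.
rewrite exprn_ege1// hyper_const_ge1// => k.
by rewrite !mulr_ge0// ?exprn_ge0// expR_ge0.
Qed.

(** The two kernels live on different grids; the sorted union of the two sets of grid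
points refines both, and on it the difference is again multilinear. *)
Lemma step_integral_hypercontractive q (k1 k2 : @step_kernel R q) :
  let D w := step_integral B k1 w - step_integral B k2 w in
  all_moments P D /\
  forall m alpha, 'EE (fun w => D w ^+ 2) < alpha ->
    'EE (fun w => D w ^+ m.*2) <= chaos_const q m * alpha ^+ m.
Proof.
move=> D.
pose pts (k : @step_kernel R q) := [seq sk_grid k i | i <- iota 0 (sk_size k).+1].
pose s := sort <=%R (undup (pts k1 ++ pts k2)).
have s_sorted : sorted <%R s by rewrite sort_lt_sorted undup_uniq.
have pts_mem (k : @step_kernel R q) i : (i <= sk_size k)%N -> sk_grid k i \in pts k.
  by move=> ik; apply: map_f; rewrite mem_iota.
have k1_s i : (i <= sk_size k1)%N -> sk_grid k1 i \in s.
  by move=> ik; rewrite mem_sort mem_undup mem_cat pts_mem.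
have k2_s i : (i <= sk_size k2)%N -> sk_grid k2 i \in s.
  by move=> ik; rewrite mem_sort mem_undup mem_cat pts_mem// orbT.
pose t i := nth 0 s i; pose n := (size s).-1.
have t_inc i : (i < n)%N -> t i < t i.+1.
  move=> ni; apply: (sorted_ltn_nth lt_trans 0 s_sorted) => //; rewrite inE.
    by rewrite (leq_trans ni)// leq_pred.
  by move: ni; rewrite /n; case: (size s).
have [c1 [c1_ninj c1E]] := step_integral_refine B s_sorted k1_s.
have [c2 [c2_ninj c2E]] := step_integral_refine B s_sorted k2_s.
pose xi i := incr B (t i) (t i.+1).
have DE : D = fun w => \sum_(l : {ffun 'I_q -> 'I_n})
    (c1 l - c2 l) * \prod_(j < q) xi (l j) w.
  apply/funext => w; rewrite /D c1E c2E -sumrB; apply: eq_bigr => l _.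
  by rewrite mulrBl.
have mD : multilinear xi n q D.
  rewrite DE; apply: multilinear_sum => l.
  have [/injectiveP li|/injectiveP lni] := boolP (injectiveb l).
    apply: multilinearZ; under eq_fun do rewrite (prod_in_image (fun i => xi i _) li).
    apply: (multilinear_prod xi (p := fun i => [exists j, l j == i :> nat])).
    by rewrite card_in_image.
  under eq_fun do rewrite c1_ninj// c2_ninj// subrr mul0r.
  exact: (multilinear_cst xi n q 0).
split.
  apply: (@polynomial_in_moments _ _ _ P n xi _ n) => //.
    by move=> i; exact: (increments_moments hB t_inc).
  exact: multilinear_polynomial mD.
move=> m alpha; apply: (@hypercontractive _ _ _ P n xi _ _ _ _ _ _ m n q D) => //.
- by move=> i; exact: (increments_moments hB t_inc).
- exact: (increments_indep hB t_inc).
- by move=> i k; exact: (increments_odd hB t_inc).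
- by move=> i k; exact: (increments_even hB t_inc).
- by move=> k; rewrite !mulr_ge0// ?exprn_ge0// expR_ge0.
Qed.

End step_hypercontractivity.

(** * Hypercontractivity of limits in L2 *)

Section l2_limit.
Context {d : measure_display} {T : measurableType d} {R : realType}.
Variable P : probability T R.
Local Notation "''EE' X" := (Rintegral P setT X) (at level 8, X at level 8).

Lemma sqr_integral_Lnorm (f : T -> R) (e : R) : 0 <= e ->
  (Lnorm P 2%:E (fun w => (f w)%:E) <= e%:E)%E ->
  (\int[P]_w (f w ^+ 2)%:E <= (e ^+ 2)%:E)%E.
Proof.
move=> e0 fe.
have -> : (\int[P]_w (f w ^+ 2)%:E = (Lnorm P 2%:E (fun w => (f w)%:E)) `^ 2)%E.
  rewrite poweR_Lnorm ?pnatr_eq0//; apply: eq_integral => w _.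
  by rewrite poweR_EFin powR_mulrn// real_normK// num_real.
rewrite -powR_mulrn// -poweR_EFin; apply: gt0_ler_poweR; rewrite ?in_itv/= ?leey ?andbT ?lee_fin//.
exact: Lnorm_ge0.
Qed.

Lemma sqr_normD_le (x y : R) : (x + y) ^+ 2 <= 2 * x ^+ 2 + 2 * y ^+ 2.
Proof. by have := sqr_ge0 (x - y); nra. Qed.

Lemma integral_monotone_limit (f : T -> R) (g : nat -> T -> R) (c : R) :
  measurable_fun setT f -> (forall n, measurable_fun setT (g n)) ->
  (forall n w, 0 <= g n w) -> (forall w, {homo g ^~ w : m n / (m <= n)%N >-> m <= n}) ->
  (forall w, g n w @[n --> \oo] --> f w) ->
  (forall n, (\int[P]_w (g n w)%:E <= c%:E)%E) ->
  (\int[P]_w (f w)%:E <= c%:E)%E.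
Proof.
move=> mf mg g0 nd_g g_f g_c.
have e : (\int[P]_w (f w)%:E = \int[P]_w (limn (fun n => (g n w)%:E)))%E.
  apply: eq_integral => w _; apply/esym/cvg_lim => //.
  by apply: cvg_EFin (g_f w); exact: nearW.
have := @cvg_monotone_convergence _ T R P setT measurableT
  (fun n w => (g n w)%:E).
rewrite -e => h.
have {}h : (\int[P]_w (g n w)%:E @[n --> \oo] --> \int[P]_w (f w)%:E)%E.
  apply: h => [n|n w _|w _ m n mn].
  - exact/measurable_EFinP.
  - by rewrite lee_fin.
  - by rewrite lee_fin nd_g.
rewrite -(cvg_lim _ h)//; apply: lime_le; first by apply/cvg_ex; eexists; exact: h.
exact: nearW.
Qed.

Definition truncation (D : T -> R) L w := Num.min `|D w| L.

Lemma truncation_ge0 D L w : 0 <= L -> 0 <= truncation D L w.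
Proof. by move=> L0; rewrite le_min normr_ge0. Qed.

Lemma truncation_moments D L : measurable_fun setT D -> 0 <= L ->
  all_moments P (truncation D L).
Proof.
move=> mD L0; apply: (@all_moments_le _ _ _ P _ (cst L)).
- by apply: measurable_minr => //; exact: measurableT_comp.
- exact: all_moments_cst.
- by move=> w; rewrite !ger0_norm ?truncation_ge0// ge_min lexx orbT.
Qed.

Variables (D : T -> R) (C : nat -> R).
Hypothesis mD : measurable_fun setT D.
Hypothesis C0 : forall m, 0 <= C m.
Hypothesis D_approx : forall e, 0 < e -> exists S,
  [/\ all_moments P S,
    forall m alpha, 'EE (fun w => S w ^+ 2) < alpha ->
      'EE (fun w => S w ^+ m.*2) <= C m * alpha ^+ m &
    (\int[P]_w ((D w - S w) ^+ 2)%:E <= e%:E)%E].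

Let truncated_moment_le m alpha L : 0 < alpha -> 0 < L ->
  (\int[P]_w (D w ^+ 2)%:E <= alpha%:E)%E ->
  'EE (fun w => truncation D L w ^+ m.+1.*2) <=
  2 ^+ m.+1.*2 * (C m.+1 * 5 ^+ m.+1 + 1) * alpha ^+ m.+1.
Proof.
move=> a0 L0 Da.
(* The first bound keeps E S^2 below 5 alpha, the second one absorbs the power of L. *)
pose e := Num.min alpha (alpha ^+ m.+1 / L ^+ m.*2).
have e0 : 0 < e by rewrite lt_min a0 divr_gt0 ?exprn_gt0.
have [S [aS S_hyp DS]] := D_approx e0.
have mS := all_moments_measurable aS.
have mDS : measurable_fun setT (fun w => D w - S w) by exact: measurable_funB.
have aT := truncation_moments mD (ltW L0).
have aTDS := truncation_moments mDS (ltW L0).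
have DS_sq : 'EE (fun w => truncation (fun w => D w - S w) L w ^+ 2) <= e.
  rewrite -lee_fin fineK; last first.
    exact/integrable_fin_num/all_moments_integrable/all_momentsX.
  apply: le_trans DS; apply: ge0_le_integral => //.
  - by move=> w _; rewrite lee_fin sqr_ge0.
  - apply/measurable_EFinP; exact: all_moments_measurable (all_momentsX 2 aTDS).
  - by apply/measurable_EFinP; exact: measurable_funX.
  - move=> w _; rewrite lee_fin -[leRHS]real_normK ?num_real//.
    by rewrite lerXn2r ?nnegrE ?truncation_ge0 ?(ltW L0)// ge_min lexx.
have S_sq : 'EE (fun w => S w ^+ 2) < 5 * alpha.
  apply: (@le_lt_trans _ _ (4 * alpha)); last by rewrite ltr_pM2r// ltr_nat.
  rewrite -lee_fin fineK; last first.
    exact/integrable_fin_num/all_moments_integrable/all_momentsX.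
  apply: (@le_trans _ _ (\int[P]_w (2%:E * (D w ^+ 2)%:E +
      2%:E * ((D w - S w) ^+ 2)%:E))%E).
    apply: ge0_le_integral => //.
    - by move=> w _; rewrite lee_fin sqr_ge0.
    - by apply/measurable_EFinP; exact: measurable_funX.
    - by apply/measurable_EFinP; apply: measurable_funD; apply: measurable_funM => //;
        exact: measurable_funX.
    - move=> w _; rewrite -!EFinM -EFinD lee_fin.
      have := sqr_normD_le (D w) (S w - D w).
      by rewrite [D w + _]addrC subrK -[(D w - S w) ^+ 2]sqrrN opprB.
  have m1 : measurable_fun setT (fun w => (D w ^+ 2)%:E).
    by apply/measurable_EFinP; exact: measurable_funX.
  have m2 : measurable_fun setT (fun w => ((D w - S w) ^+ 2)%:E).
    by apply/measurable_EFinP; exact: measurable_funX.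
  rewrite ge0_integralD//; first last.
  - exact: measurable_funeM.
  - by move=> w _; rewrite -EFinM lee_fin mulr_ge0// sqr_ge0.
  - exact: measurable_funeM.
  - by move=> w _; rewrite -EFinM lee_fin mulr_ge0// sqr_ge0.
  rewrite !ge0_integralZl_EFin//; [|by move=> w _; rewrite lee_fin sqr_ge0..].
  apply: (@le_trans _ _ (2%:E * alpha%:E + 2%:E * e%:E)%E).
    by apply: leeD; rewrite lee_pmul2l.
  rewrite -!EFinM -EFinD lee_fin.
  have : e <= alpha by rewrite ge_min lexx.
  by lra.
have pt w : truncation D L w ^+ m.+1.*2 <= 2 ^+ m.+1.*2 *
    (S w ^+ m.+1.*2 +
     L ^+ m.*2 * truncation (fun w => D w - S w) L w ^+ 2).
  set u := truncation (fun w => D w - S w) L w.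
  have u0 : 0 <= u by exact/truncation_ge0/ltW.
  have uL : u <= L by rewrite ge_min lexx orbT.
  have Tu : truncation D L w <= `|S w| + u.
    rewrite /u /truncation; have [h|h] := leP `|D w - S w| L.
      rewrite ge_min (_ : `|D w| <= _)//.
      by rewrite -{1}(subrK (S w) (D w)) addrC ler_normD.
    by rewrite ge_min lerDr normr_ge0 orbT.
  apply: (@le_trans _ _ ((`|S w| + u) ^+ m.+1.*2)).
    by rewrite lerXn2r ?nnegrE ?addr_ge0 ?truncation_ge0 ?(ltW L0).
  apply: le_trans (ler_norm _) _; apply: le_trans (ler_powD _ _ _) _.
  rewrite ler_wpM2l ?exprn_ge0// !normrX normr_id (ger0_norm u0).
  apply: lerD; last first.
    by rewrite doubleS -addn2 exprD ler_wpM2r ?exprn_ge0// lerXn2r ?nnegrE// ltW.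
  by rewrite -normrX ger0_norm// exprn_even_ge0// odd_double.
have aS2 := all_momentsX m.+1.*2 aS.
have aTDS2 := all_momentsZ (L ^+ m.*2) (all_momentsX 2 aTDS).
apply: (@le_trans _ _ (2 ^+ m.+1.*2 * ('EE (fun w => S w ^+ m.+1.*2) +
    L ^+ m.*2 * 'EE (fun w => truncation (fun w => D w - S w) L w ^+ 2)))).
  rewrite -(expectedZ (L ^+ m.*2) (all_momentsX 2 aTDS)).
  rewrite -(expectedD aS2 aTDS2) -(expectedZ _ (all_momentsD aS2 aTDS2)).
  apply: expected_le => //; first exact: all_momentsX.
  by apply: all_momentsZ; exact: all_momentsD.
rewrite -mulrA ler_wpM2l ?exprn_ge0// mulrDl mul1r.
apply: lerD; first by rewrite -mulrA -exprMn; exact: S_hyp.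
apply: (@le_trans _ _ (L ^+ m.*2 * e)); first by rewrite ler_wpM2l// exprn_ge0// ltW.
rewrite mulrC -ler_pdivlMr ?exprn_gt0// /e ge_min lexx orbT//.
Qed.

(** Truncated moments are continuous for the L2-distance: min(|D|, L)^(2m) is at most
2^(2m) (S^(2m) + L^(2m-2) (D - S)^2), and the last term has arbitrarily small mean
for fixed L. Monotone convergence then lets L tend to infinity. *)
Lemma l2_limit_hypercontractive :
  (forall m alpha, 0 < alpha -> (\int[P]_w (D w ^+ 2)%:E <= alpha%:E)%E ->
    (\int[P]_w (D w ^+ m.+1.*2)%:E <=
     (2 ^+ m.+1.*2 * (C m.+1 * 5 ^+ m.+1 + 1) * alpha ^+ m.+1)%:E)%E).
Proof.
move=> m alpha a0 Da.
have aT n : all_moments P (truncation D n.+1%:R) by exact: truncation_moments.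
apply: (@integral_monotone_limit _ (fun n w => truncation D n.+1%:R w ^+ m.+1.*2)).
- exact: measurable_funX.
- by move=> n; exact: all_moments_measurable (all_momentsX _ (aT n)).
- by move=> n w; rewrite exprn_ge0// truncation_ge0.
- move=> w i j ij; rewrite lerXn2r ?nnegrE ?truncation_ge0//.
  by rewrite le_min ge_min lexx/= ge_min ler_nat ltnS ij orbT.
- move=> w.
  have -> : D w ^+ m.+1.*2 = `|D w| ^+ m.+1.*2.
    by rewrite -normrX ger0_norm// exprn_even_ge0// odd_double.
  apply: cvg_near_cst; near=> n; rewrite /truncation min_l//.
  near: n; exists (Num.truncn `|D w|) => // n /= Dn.
  by rewrite ltW// (lt_le_trans (truncnS_gt _))// ler_nat ltnS.
- move=> n.
  have -> : (\int[P]_w (truncation D n.+1%:R w ^+ m.+1.*2)%:E =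
      ('EE (fun w => truncation D n.+1%:R w ^+ m.+1.*2))%:E)%E.
    rewrite fineK//; exact/integrable_fin_num/all_moments_integrable/all_momentsX.
  by rewrite lee_fin truncated_moment_le.
Unshelve. all: by end_near. Qed.

Lemma l2_limit_sqr_lty : (\int[P]_w (D w ^+ 2)%:E < +oo)%E.
Proof.
have [S [aS _ DS]] := D_approx ltr01.
have mS := all_moments_measurable aS.
have aS2 := all_momentsX 2 aS.
have mDS : measurable_fun setT (fun w => (D w - S w) ^+ 2).
  by apply: measurable_funX; exact: measurable_funB.
have iDS : P.-integrable setT (fun w => ((D w - S w) ^+ 2)%:E).
  apply/integrableP; split; first exact/measurable_EFinP.
  under eq_integral do rewrite /= ger0_norm ?sqr_ge0//.
  by rewrite (le_lt_trans DS)// ltry.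
have iS : P.-integrable setT (fun w => (S w ^+ 2)%:E) by exact: all_moments_integrable aS2.
have i1 : P.-integrable setT (fun w => (2%:E * (S w ^+ 2)%:E +
    2%:E * ((D w - S w) ^+ 2)%:E)%E).
  by apply: integrableD => //; exact: integrableZl.
have : P.-integrable setT (fun w => (D w ^+ 2)%:E).
  apply: (le_integrable measurableT _ _ i1).
    by apply/measurable_EFinP; exact: measurable_funX.
  move=> w _; rewrite -!EFinM -EFinD lee_fin !ger0_norm ?sqr_ge0//; last first.
    by rewrite addr_ge0// mulr_ge0// sqr_ge0.
  by have := sqr_normD_le (S w) (D w - S w); rewrite addrC subrK.
move=> /integrableP[_]; apply: le_lt_trans.
rewrite le_eqVlt; apply/orP; left; apply/eqP; apply: eq_integral => w _ /=.
by rewrite ger0_norm ?sqr_ge0.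
Qed.

Lemma l2_limit_moments : all_moments P D.
Proof.
have mn n : measurable_fun setT (fun w => (D w ^+ n)%:E).
  by apply/measurable_EFinP; exact: measurable_funX.
have [a a0 Da] : exists2 a, 0 < a & (\int[P]_w (D w ^+ 2)%:E <= a%:E)%E.
  have fin : (\int[P]_w (D w ^+ 2)%:E \is a fin_num)%E.
    rewrite ge0_fin_numE; first exact: l2_limit_sqr_lty.
    by apply: integral_ge0 => w _; rewrite lee_fin sqr_ge0.
  exists (fine (\int[P]_w (D w ^+ 2)%:E) + 1).
    by rewrite ltr_wpDl// fine_ge0// integral_ge0// => w _; rewrite lee_fin sqr_ge0.
  by rewrite EFinD fineK// leeDl// lee_fin.
split=> // n.
have ieven m : P.-integrable setT (fun w => (D w ^+ m.*2)%:E).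
  case: m => [|m].
    by apply: (all_moments_integrable (all_moments_cst P 1)).
  apply/integrableP; split=> //.
  under eq_integral do rewrite /= ger0_norm ?exprn_even_ge0 ?odd_double//.
  by rewrite (le_lt_trans (l2_limit_hypercontractive m a0 Da))// ltry.
have i1 : P.-integrable setT (fun w => ((D w ^+ 0.*2)%:E + (D w ^+ n.*2)%:E)%E).
  exact: integrableD.
apply: (le_integrable measurableT _ _ i1); first exact: mn.
move=> w _ /=; rewrite lee_fin expr0.
have := ler_normM_sqr 1 (D w ^+ n).
by rewrite mul1r expr1n -exprM muln2.
Qed.

End l2_limit.

(** * From pointwise bounds to bounds on variances *)

Section bounded_family.
Context {d : measure_display} {T : measurableType d} {R : realType}.
Variable P : probability T R.
Local Notation "''EE' X" := (Rintegral P setT X) (at level 8, X at level 8).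

(** Choose k such that, outside an event of probability at most 1 / (4 K), all X n i are
bounded by k. On this event X^2 <= k^2; off it, X^2 <= e X^4 + 1 / (4 e). With
e = 1 / (4 K s), where s = E X^2, taking means gives s <= k^2 + s / 4 + s / 4. *)
Lemma variance_bounded (X : nat -> nat -> T -> R) (K : R) : 0 < K ->
  (forall n i, all_moments P (X n i)) ->
  (forall n i alpha, 0 < alpha -> 'EE (fun w => X n i w ^+ 2) <= alpha ->
    'EE (fun w => X n i w ^+ 4) <= K * alpha ^+ 2) ->
  (forall w, exists c, forall n i, `|X n i w| <= c) ->
  exists2 v, 0 < v & forall n i, 'EE (fun w => X n i w ^+ 2) <= v.
Proof.
move=> K0 aX hyp bX.
pose A (k : nat) := \bigcap_n \bigcap_i [set w | `|X n i w| <= k%:R].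
have mA k : measurable (A k).
  apply: bigcapT_measurable => n; apply: bigcapT_measurable => i.
  rewrite -[X in measurable X]setTI.
  apply: measurable_fun_ler => //; apply: measurableT_comp => //.
  exact: all_moments_measurable (aX n i).
have AT : \bigcup_k A k = setT.
  apply/seteqP; split=> // w _; have [c cw] := bX w.
  exists (Num.truncn c).+1 => // n _ i _ /=.
  by rewrite (le_trans (cw _ _))// ltW// truncnS_gt.
have Acvg : P (A k) @[k --> \oo] --> 1%E.
  rewrite -(@probability_setT _ _ _ P) -AT; apply: nondecreasing_cvg_mu => //.
    exact: bigcup_measurable.
  move=> k l kl; apply/subsetPset => w Aw n _ i _ /=.
  by rewrite (le_trans (Aw n I i I))// ler_nat.
have [k Ak] : exists k, 'EE (\1_(~` A k)) <= (4 * K)^-1.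
  have /fine_cvgP[_ /cvgrPdist_le/(_ (4 * K)^-1)] := Acvg.
  rewrite invr_gt0 mulr_gt0// => /(_ isT) [k _ /(_ k (leqnn _))] /= h.
  exists k; rewrite expected_indic; last exact: measurableC.
  rewrite probability_setC// fineB// ?fin_num_measure//=.
  exact: le_trans (ler_norm _) h.
exists (2 * k%:R ^+ 2 + 1) => [|n i]; first by rewrite ltr_wpDl// mulr_ge0// sqr_ge0.
set s := 'EE _.
have s0 : 0 <= s by apply: Rintegral_ge0 => w _; exact: sqr_ge0.
have [->|sN0] := eqVneq s 0; first by rewrite addr_ge0// mulr_ge0// sqr_ge0.
have {}s0 : 0 < s by rewrite lt_def sN0.
suff : s <= k%:R ^+ 2 + (s / 4 + s / 4) by lra.
pose e := (4 * K * s)^-1.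
have e0 : 0 < e by rewrite invr_gt0 !mulr_gt0.
have aA : all_moments P (\1_(~` A k) : T -> R).
  by apply: all_moments_indic; exact: measurableC.
have a1 := all_moments_cst P (k%:R ^+ 2 : R).
have a4 := all_momentsX 4 (aX n i).
have aS := all_momentsD (all_momentsZ e a4) (all_momentsZ (K * s) aA).
apply: (@le_trans _ _ ('EE (fun w => cst (k%:R ^+ 2) w +
    (e * X n i w ^+ 4 + (K * s) * \1_(~` A k) w)))).
  apply: expected_le; [exact: all_momentsX|exact: all_momentsD|move=> w].
  rewrite indicE /cst; have [|wA] := boolP (w \in ~` A k); last first.
    have {wA}Aw : A k w by apply: contrapT => Aw; move/negP: wA; apply; rewrite inE.
    rewrite mulr0 addr0 (@le_trans _ _ (k%:R ^+ 2))//; last first.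
      by rewrite lerDl mulr_ge0 ?(ltW e0)// exprn_even_ge0.
    rewrite -[leLHS]real_normK ?num_real// lerXn2r ?nnegrE//.
    exact: Aw.
  move=> _; rewrite mulr1.
  have Ke : K * s = (4 * e)^-1 by rewrite /e; field; rewrite !gt_eqF.
  rewrite Ke (@le_trans _ _ (e * X n i w ^+ 4 + (4 * e)^-1))//; last first.
    by rewrite lerDr sqr_ge0.
  rewrite -subr_ge0.
  have -> : e * X n i w ^+ 4 + (4 * e)^-1 - X n i w ^+ 2 =
      (2 * e * X n i w ^+ 2 - 1) ^+ 2 * (4 * e)^-1 by field; rewrite gt_eqF.
  by rewrite mulr_ge0 ?sqr_ge0// invr_ge0 mulr_ge0// ltW.
rewrite (expectedD a1 aS) (expected_cst P (k%:R ^+ 2)).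
rewrite (expectedD (all_momentsZ e a4) (all_momentsZ (K * s) aA)).
rewrite (expectedZ _ a4) (expectedZ _ aA) lerD2l; apply: lerD.
  apply: (@le_trans _ _ (e * (K * s ^+ 2))).
    by rewrite ler_wpM2l ?(ltW e0)//; exact: hyp.
  by rewrite le_eqVlt; apply/orP; left; apply/eqP; rewrite /e; field; rewrite !gt_eqF.
apply: (@le_trans _ _ (K * s * (4 * K)^-1)); first by rewrite ler_wpM2l// ltW// mulr_gt0.
by rewrite le_eqVlt; apply/orP; left; apply/eqP; field; rewrite gt_eqF.
Qed.

End bounded_family.

(** * Chaining along grids of mesh T / 16^n *)

Section grid.
Context {R : realType}.
Variable T : R.
Hypothesis T0 : 0 < T.

Definition grid N i : R := T * i%:R / 16 ^+ N.

Let p16 N : 0 < 16 ^+ N :> R. Proof. by rewrite exprn_gt0. Qed.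

Lemma grid_itv N i : (i <= 16 ^ N)%N -> grid N i \in `[0, T].
Proof.
move=> iN; rewrite in_itv/= /grid !mulr_ge0 ?invr_ge0 ?(ltW T0) ?(ltW (p16 N))//=.
by rewrite ler_pdivrMr// ler_pM2l// -natrX ler_nat.
Qed.

Lemma grid0 N : grid N 0 = 0.
Proof. by rewrite /grid mulr0 mul0r. Qed.

Lemma gridS N i : grid N.+1 (16 * i) = grid N i.
Proof. by rewrite /grid natrM exprS; field; rewrite gt_eqF. Qed.

Lemma grid_step N i : grid N i.+1 - grid N i = T / 16 ^+ N.
Proof. by rewrite /grid -natr1; field; rewrite gt_eqF. Qed.

(** The point of the grid just below t. *)
Lemma grid_near N t : t \in `[0, T] ->
  exists2 i, (i <= 16 ^ N)%N & `|t - grid N i| <= T / 16 ^+ N.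
Proof.
rewrite in_itv/= => /andP[t0 tT].
pose x := t * 16 ^+ N / T.
have x0 : 0 <= x by rewrite divr_ge0 ?mulr_ge0 ?(ltW T0)// ltW.
have tx : t = T * x / 16 ^+ N by rewrite /x; field; rewrite !gt_eqF.
exists (Num.truncn x).
  rewrite -(@ler_nat R) natrX; apply: (@le_trans _ _ x); first by rewrite truncn_le.
  by rewrite /x ler_pdivrMr// mulrC ler_pM2l.
have h1 : (Num.truncn x)%:R <= x by rewrite truncn_le.
have h2 := truncnS_gt x.
rewrite /grid tx -mulrBl -mulrBr normrM normrM (gtr0_norm T0).
have i16 : 0 < (16 ^+ N : R)^-1 by rewrite invr_gt0.
rewrite (gtr0_norm i16) ler_pM2r// ler_piMr ?(ltW T0)//.
rewrite -natr1 in h2.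
by rewrite ger0_norm ?subr_ge0//; lra.
Qed.

Lemma within_continuous_ge_grid (f : R -> R) (c : R) :
  {within `[0, T], continuous f} ->
  (forall N i, (i <= 16 ^ N)%N -> c <= f (grid N i)) ->
  forall t, t \in `[0, T] -> c <= f t.
Proof.
move=> cf fc t tT; rewrite leNgt; apply/negP => ft.
have /subspace_continuousP/(_ t tT)/cvgrPdist_lt/(_ (c - f t)) := cf.
rewrite subr_gt0 near_withinE => /(_ ft)/nbhs_ballP[e /= e0 te].
have [N Ne] : exists N : nat, T / 16 ^+ N < e.
  exists (Num.truncn (T / e)).+1; rewrite ltr_pdivrMr// mulrC -ltr_pdivrMr//.
  apply: (lt_le_trans (truncnS_gt _)).
  rewrite -natrX ler_nat; exact/ltnW/ltn_expl.
have [i iN ti] := grid_near N tT.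
have := te (grid N i) (le_lt_trans ti Ne) (grid_itv iN).
by have := ler_norm (f (grid N i) - f t); have := fc N i iN; rewrite distrC; lra.
Qed.

End grid.

Lemma cvg_pow {R : realType} (u : nat -> R) (l : R) k :
  u n @[n --> \oo] --> l -> u n ^+ k @[n --> \oo] --> l ^+ k.
Proof.
move=> ul; elim: k => [|k ih].
  by under eq_fun do rewrite expr0; rewrite expr0; exact: cvg_cst.
by under eq_fun do rewrite exprS; rewrite exprS; exact: cvgM.
Qed.

(** A point of the grid of level N + 1 is reached from one of level N in at most 15
steps, each of size at most u / 2^(N + 1). The increments of all levels thus sum to
a geometric series. *)
Lemma chaining {R : realType} (T : R) (z : R -> R) (u : R) (N : nat) :
  0 < T -> 0 <= u -> z 0 = 0 ->
  (forall n i, (n <= N)%N -> (i < 16 ^ n)%N ->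
    `|z (grid T n i.+1) - z (grid T n i)| <= u / 2 ^+ n) ->
  forall i, (i <= 16 ^ N)%N -> `|z (grid T N i)| <= 16 * u * (2 - 2 ^- N).
Proof.
move=> T0 u0 z0; elim: N => [|N ih] zu i iN.
  case: i iN => [|[|//]] _; first by rewrite grid0 z0 normr0 !mulr_ge0// expr0; lra.
  have := zu 0%N 0%N isT isT; rewrite grid0 z0 subr0 !expr0 divr1; lra.
have step b a : (16 * a + b <= 16 ^ N.+1)%N ->
    `|z (grid T N.+1 (16 * a + b))| <= `|z (grid T N a)| + b%:R * (u / 2 ^+ N.+1).
  elim: b => [|b ihb] ab; first by rewrite addn0 gridS// mul0r addr0.
  rewrite addnS in ab *.
  have := zu N.+1 _ (leqnn _) ab.
  have eb : b.+1%:R = b%:R + 1 :> R by rewrite natr1.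
  have := ihb (ltnW ab); rewrite eb.
  set x := z (grid T N.+1 (16 * a + b)); set y := z (grid T N.+1 _.+1).
  have := ler_normD x (y - x).
  by rewrite [x + _]addrC subrK mulrDl mul1r; lra.
have iE : i = (16 * (i %/ 16) + i %% 16)%N by rewrite mulnC -divn_eq.
have aN : (i %/ 16 <= 16 ^ N)%N by rewrite -(@mulKn (16 ^ N) 16)// -expnS leq_div2r.
rewrite iE; apply: le_trans (step _ _ _) _; first by rewrite -iE.
have h := ih (fun n j nN => zu n j (leqW nN)) _ aN.
have b16 : (i %% 16)%:R <= 16 :> R by rewrite ler_nat ltnW// ltn_mod.
have v0 : 0 <= u / 2 ^+ N.+1 by rewrite divr_ge0// exprn_ge0.
have e : 2 ^- N = 2 * 2 ^- N.+1 :> R by rewrite exprS; field; rewrite expf_neq0.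
rewrite e in h.
have := ler_wpM2r v0 b16; lra.
Qed.

Section path_sup_moments.
Context {d : measure_display} {Omega : measurableType d} {R : realType}.
Variables (P : probability Omega R) (T : R) (Z : R -> Omega -> R).
Local Notation "''EE' X" := (Rintegral P setT X) (at level 8, X at level 8).
Hypothesis T0 : 0 < T.
Hypothesis Z0 : forall w, Z 0 w = 0.
Hypothesis Z_moments : forall t, t \in `[0, T] -> all_moments P (Z t).
Hypothesis Z_holder : forall w, exists c, forall s t,
  s \in `[0, T] -> t \in `[0, T] -> `|Z t w - Z s w| <= c * Num.sqrt `|t - s|.
Variable K : nat -> R.
Hypothesis K0 : forall m, 0 < K m.
Hypothesis Z_hyper : forall s t m alpha, s \in `[0, T] -> t \in `[0, T] ->
  0 < alpha -> 'EE (fun w => (Z t w - Z s w) ^+ 2) <= alpha ->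
  'EE (fun w => (Z t w - Z s w) ^+ m.+1.*2) <= K m.+1 * alpha ^+ m.+1.

Let g := grid T.
Let Delta n i w := Z (g n i.+1) w - Z (g n i) w.

Let gE n i : (i <= 16 ^ n)%N -> g n i \in `[0, T].
Proof. exact: grid_itv. Qed.

Let Delta_moments n i : (i < 16 ^ n)%N -> all_moments P (Delta n i).
Proof. by move=> ni; apply: all_momentsB; apply/Z_moments/gE => //; exact: ltnW. Qed.

Let Z_holder_pos w : exists2 c, 0 <= c & forall s t,
  s \in `[0, T] -> t \in `[0, T] -> `|Z t w - Z s w| <= c * Num.sqrt `|t - s|.
Proof.
have [c cw] := Z_holder w; exists `|c|; first by [].
by move=> s t sT tT; rewrite (le_trans (cw _ _ sT tT))// ler_wpM2r ?ler_norm// sqrtr_ge0.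
Qed.

Let sqrt16 n : Num.sqrt (T / 16 ^+ n) = Num.sqrt T / 4 ^+ n.
Proof.
rewrite sqrtrM ?(ltW T0)//; congr (_ * _).
have -> : (16 ^+ n)^-1 = ((4 ^+ n)^-1) ^+ 2 :> R.
  by rewrite exprVn -exprM mulnC exprM; congr (_ ^+ _)^-1; rewrite -natrX.
by rewrite sqrtr_sqr ger0_norm// invr_ge0 exprn_ge0.
Qed.

(** The variables 4^n Delta n i are the increments divided by the square root of the
mesh, up to the factor sqrt T, hence pointwise bounded. *)
Let Delta_variance : exists2 v, 0 < v &
  forall n i, (i < 16 ^ n)%N -> 'EE (fun w => Delta n i w ^+ 2) <= v / 16 ^+ n.
Proof.
pose X n i w := if (i < 16 ^ n)%N then 4 ^+ n * Delta n i w else 0.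
have aX n i : all_moments P (X n i).
  rewrite /X; have [ni|_] := ltnP i (16 ^ n); last exact: (all_moments_cst P 0).
  exact/all_momentsZ/Delta_moments.
have XE n i k : (i < 16 ^ n)%N ->
    'EE (fun w => X n i w ^+ k) = 4 ^+ n ^+ k * 'EE (fun w => Delta n i w ^+ k).
  move=> ni; rewrite -expectedZ; last exact/all_momentsX/Delta_moments.
  by apply: eq_Rintegral => w _; rewrite /X ni exprMn.
have p4 n : 0 < 4 ^+ n :> R by rewrite exprn_gt0.
have [||v v0 Xv] := @variance_bounded _ _ _ P X (K 2) (K0 2) aX.
- move=> n i alpha a0; have [ni|ni] := ltnP i (16 ^ n); last first.
    have -> : (fun w => X n i w ^+ 4) = cst 0.
      by apply/funext => w; rewrite /X ltnNge ni expr0n.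
    by move=> _; rewrite (expected_cst P 0) mulr_ge0 ?(ltW (K0 2))// sqr_ge0.
  rewrite !XE// => h.
  have h1 : 'EE (fun w => Delta n i w ^+ 2) <= alpha / 4 ^+ n ^+ 2.
    by rewrite ler_pdivlMr ?exprn_gt0// mulrC.
  have := @Z_hyper (g n i) (g n i.+1) 1 _ (gE (ltnW ni)) (gE ni) _ h1.
  rewrite divr_gt0 ?exprn_gt0// => /(_ isT).
  move=> h2; rewrite -ler_pdivlMl ?exprn_gt0//; apply: le_trans h2 _.
  rewrite le_eqVlt; apply/orP; left; apply/eqP; field.
  by rewrite expf_neq0// gt_eqF.
- move=> w; have [c c0 cw] := Z_holder_pos w; exists (c * Num.sqrt T) => n i.
  rewrite /X; have [ni|ni] := ltnP i (16 ^ n); last first.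
    by rewrite normr0 mulr_ge0// sqrtr_ge0.
  rewrite normrM (gtr0_norm (p4 n)) -ler_pdivlMl//.
  apply: le_trans (cw _ _ (gE (ltnW ni)) (gE ni)) _.
  rewrite /g grid_step// ger0_norm ?sqrt16; last first.
    by rewrite divr_ge0 ?(ltW T0)// exprn_ge0.
  by rewrite le_eqVlt; apply/orP; left; apply/eqP; ring.
- exists v => // n i ni; have := Xv n i; rewrite XE// => h.
  rewrite ler_pdivlMr ?exprn_gt0// mulrC; apply: le_trans h.
  rewrite le_eqVlt; apply/orP; left; apply/eqP; congr (_ * _).
  by rewrite -exprM mulnC exprM; congr (_ ^+ _); rewrite -natrX.
Qed.

Definition grid_sup N w : R := \big[Num.max/0]_(i < (16 ^ N).+1) `|Z (grid T N i) w|.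

Let grid_sup_ge0 N w : 0 <= grid_sup N w.
Proof. exact: bigmax_ge_id. Qed.

Let grid_sup_moments N : all_moments P (grid_sup N).
Proof.
have h (I : Type) (r : seq I) (F : I -> Omega -> R) :
    (forall i, all_moments P (F i)) ->
    all_moments P (fun w => \big[Num.max/0]_(i <- r) `|F i w|).
  move=> aF; elim: r => [|i r ih].
    under eq_fun do rewrite big_nil; exact: (all_moments_cst P 0).
  under eq_fun do rewrite big_cons.
  have mi : measurable_fun setT (fun w => `|F i w|).
    by apply: measurableT_comp => //; exact: all_moments_measurable (aF i).
  have ai : all_moments P (fun w => `|F i w|).
    by apply: (all_moments_le mi (aF i)) => w; rewrite normr_id.
  apply: (@all_moments_le _ _ _ P _ (fun w => `|F i w| +
      \big[Num.max/0]_(j <- r) `|F j w|)).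
  - apply: measurable_maxr => //; exact: all_moments_measurable ih.
  - exact: all_momentsD.
  - move=> w; have m0 : 0 <= \big[Num.max/0]_(j <- r) `|F j w|.
      exact: bigmax_ge_id.
    rewrite [leLHS]ger0_norm ?le_max ?normr_ge0// [leRHS]ger0_norm ?addr_ge0//.
    by rewrite ge_max lerDl lerDr normr_ge0 m0.
by apply: (h _ _ (fun (i : 'I_(16 ^ N).+1) => Z (grid T N i))) => i;
  apply/Z_moments/gE; rewrite -ltnS.
Qed.

(** The weights 4^(m n) are chosen so that the energy bounds the 2m-th power of every
2^n |Delta n i|, which is the input of [chaining], while its mean stays bounded:
the level n contributes at most a multiple of 4^(m n) 16^n 16^(- n m) <= 2^(- n)
once m >= 3. *)
Let energy m N w := \sum_(n < N.+1) 4 ^+ (m * n) *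
  \sum_(i < 16 ^ n) Delta n i w ^+ m.*2.

Let even_ge0 (x : R) m : 0 <= x ^+ m.*2.
Proof. by rewrite exprn_even_ge0// odd_double. Qed.

Let energy_ge0 m N w : 0 <= energy m N w.
Proof.
by apply: sumr_ge0 => n _; rewrite mulr_ge0 ?exprn_ge0// sumr_ge0.
Qed.

(** With u the 2m-th root of the energy, [chaining] bounds the path by 32 u on the
grid. *)
Let grid_sup_le m N w : (0 < m)%N ->
  grid_sup N w ^+ m.*2 <= 32 ^+ m.*2 * energy m N w.
Proof.
move=> m0; have m20 : (0 < m.*2)%N by rewrite double_gt0.
pose u := energy m N w `^ (m.*2%:R^-1).
have u0 : 0 <= u by exact: powR_ge0.
have uE : u ^+ m.*2 = energy m N w.
  by rewrite -powR_mulrn// -powRrM mulVf ?powRr1// pnatr_eq0 -lt0n.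
rewrite -uE -exprMn lerXn2r ?nnegrE ?mulr_ge0//.
apply/bigmax_leP; split=> [|i _]; first by rewrite mulr_ge0.
have h : `|Z (grid T N i) w| <= 16 * u * (2 - 2 ^- N).
  apply: (@chaining _ T (Z^~ w) u N) => //; last by rewrite -ltnS.
  move=> n j nN jn.
  have p2 : 0 < 2 ^+ n :> R by rewrite exprn_gt0.
  rewrite ler_pdivlMr// -(@ler_pXn2r _ m.*2)// ?nnegrE ?mulr_ge0 ?(ltW p2)//.
  rewrite uE exprMn -normrX (ger0_norm (even_ge0 _ _)).
  rewrite /energy (bigD1 (Ordinal (nN : (n < N.+1)%N)))//= (bigD1 (Ordinal jn))//=.
  apply: ler_wpDr.
    by apply: sumr_ge0 => k _; rewrite mulr_ge0 ?exprn_ge0// sumr_ge0.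
  rewrite mulrDr; apply: ler_wpDr.
    by rewrite mulr_ge0 ?exprn_ge0// sumr_ge0.
  rewrite mulrC le_eqVlt; apply/orP; left; apply/eqP; congr (_ * _).
  by rewrite -exprM -muln2 mulnA mulnC exprM mulnC; congr (_ ^+ _); rewrite -natrX.
apply: le_trans h _.
have : 0 <= 2 ^- N :> R by rewrite invr_ge0 exprn_ge0.
by nra.
Qed.

Let sum_half N : \sum_(n < N) 2 ^- n <= 2 - 2 * 2 ^- N :> R.
Proof.
elim: N => [|N ih]; first by rewrite big_ord0 expr0 invr1 mulr1 subrr.
rewrite big_ord_recr/=.
have e : 2 ^- N = 2 * 2 ^- N.+1 :> R by rewrite exprS; field; rewrite expf_neq0.
by rewrite e in ih *; lra.
Qed.

Lemma grid_sup_moment_bounded m : exists c,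
  forall N, 'EE (fun w => grid_sup N w ^+ m.+3.*2) <= c.
Proof.
have [v v0 Dv] := Delta_variance.
have [M M3 ->] : exists2 M, (3 <= M)%N & m.+3 = M by exists m.+3.
have Kv0 : 0 <= K M * v ^+ M by rewrite mulr_ge0 ?exprn_ge0// ltW.
have ZM s t alpha : s \in `[0, T] -> t \in `[0, T] -> 0 < alpha ->
    'EE (fun w => (Z t w - Z s w) ^+ 2) <= alpha ->
    'EE (fun w => (Z t w - Z s w) ^+ M.*2) <= K M * alpha ^+ M.
  by case: M M3 {Kv0} => // M _; exact: Z_hyper.
exists (32 ^+ M.*2 * (K M * v ^+ M * 2)) => N.
have aD n (i : 'I_(16 ^ n)) : all_moments P (fun w => Delta n i w ^+ M.*2).
  exact/all_momentsX/Delta_moments.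
have aS n : all_moments P (fun w => \sum_(i < 16 ^ n) Delta n i w ^+ M.*2).
  by apply: all_moments_sum => i; exact: aD.
have aE n : all_moments P (fun w => 4 ^+ (M * n) *
    \sum_(i < 16 ^ n) Delta n i w ^+ M.*2) by exact: all_momentsZ.
have aEN : all_moments P (energy M N).
  by apply: (@all_moments_sum _ _ _ P _ _ (fun n : 'I_N.+1 => _)) => n; exact: aE.
apply: (@le_trans _ _ ('EE (fun w => 32 ^+ M.*2 * energy M N w))).
  apply: expected_le; [exact: all_momentsX|exact: all_momentsZ|].
  by move=> w; apply: grid_sup_le; exact: leq_trans M3.
rewrite expectedZ// ler_wpM2l ?exprn_ge0//.
have -> : 'EE (energy M N) = \sum_(n < N.+1) 4 ^+ (M * n) *
    \sum_(i < 16 ^ n) 'EE (fun w => Delta n i w ^+ M.*2).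
  have -> := @expected_sum _ _ _ P _ (index_enum 'I_N.+1)
    (fun n w => 4 ^+ (M * n) * \sum_(i < 16 ^ n) Delta n i w ^+ M.*2)
    (fun n => aE n).
  apply: eq_bigr => n _; rewrite (expectedZ _ (aS n)); congr (_ * _).
  exact: (@expected_sum _ _ _ P _ _ (fun (i : 'I_(16 ^ n)) w => Delta n i w ^+ M.*2)).
apply: (@le_trans _ _ (\sum_(n < N.+1) K M * v ^+ M * 2 ^- n)); last first.
  rewrite -mulr_sumr ler_wpM2l//; apply: (le_trans (sum_half N.+1)).
  by have : 0 <= 2 ^- N.+1 :> R; [rewrite invr_ge0 exprn_ge0|lra].
apply: ler_sum => n _.
apply: (@le_trans _ _ (4 ^+ (M * n) * \sum_(i < 16 ^ n) (K M * (v / 16 ^+ n) ^+ M))).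
  rewrite ler_wpM2l ?exprn_ge0//; apply: ler_sum => i _.
  apply: ZM; [exact/gE/ltnW|exact/gE| |exact: Dv].
  by rewrite divr_gt0// exprn_gt0.
rewrite sumr_const card_ord -[(K M * _) *+ _]mulr_natr (exprMn _ v) exprVn natrX.
have -> : 4 ^+ (M * n) * (K M * (v ^+ M * (16 ^+ n ^+ M)^-1) * 16 ^+ n) =
    K M * v ^+ M * (4 ^+ (M * n) * 16 ^+ n * (16 ^+ n ^+ M)^-1) by ring.
rewrite ler_wpM2l// ler_pdivrMr ?exprn_gt0// ler_pdivlMl ?exprn_gt0//.
rewrite -(exprM 16) (mulnC n M) !(exprM _ M n) -!exprMn lerXn2r ?nnegrE//.
have -> : 16 ^+ M = 4 ^+ M * 4 ^+ M :> R by rewrite -exprMn -natrM.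
(* The goal 2 (4^M 16) <= 16^M amounts to 32 <= 4^M, true from M = 3 on. *)
have : 4 ^+ 3 <= 4 ^+ M :> R by rewrite ler_weXn2l// ler1n.
have p4 : 0 <= 4 ^+ M :> R by rewrite exprn_ge0.
by move=> h; have := ler_wpM2l p4 h; rewrite !exprS expr0; lra.
Qed.

Let in0T : 0 \in `[0, T]%R.
Proof. by rewrite in_itv/= lexx ltW. Qed.

Let Z_has_sup w : has_sup [set `|Z s w| | s in `[0, T]].
Proof.
split; first by exists `|Z 0 w|, 0.
have [c c0 cw] := Z_holder_pos w.
exists (c * Num.sqrt T) => _ [s /= sT <-].
have := cw 0 s in0T sT; rewrite Z0 !subr0; move/le_trans; apply.
rewrite ler_wpM2l// ler_wsqrtr//.
by move: sT; rewrite in_itv/= => /andP[s0 sT]; rewrite ger0_norm.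
Qed.

Lemma le_path_sup w t : t \in `[0, T] -> `|Z t w| <= path_sup T Z w.
Proof. by move=> tT; apply: ub_le_sup; [case: (Z_has_sup w)|exists t]. Qed.

Let grid_sup_le_path_sup N w : grid_sup N w <= path_sup T Z w.
Proof.
apply/bigmax_leP; split=> [|i _].
  exact: le_trans (normr_ge0 (Z 0 w)) (le_path_sup w in0T).
by apply/le_path_sup/gE; rewrite -ltnS.
Qed.

Let grid_sup_nondecreasing w : {homo grid_sup ^~ w : m n / (m <= n)%N >-> m <= n}.
Proof.
apply: homo_leq => // [y x z|N]; first exact: le_trans.
apply/bigmax_leP; split=> [|i _]; first exact: grid_sup_ge0.
rewrite -gridS//.
have iN : (16 * i < (16 ^ N.+1).+1)%N.
  by rewrite ltnS expnS leq_pmul2l// -ltnS.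
exact: (le_bigmax _ (fun j : 'I_(16 ^ N.+1).+1 => `|Z (grid T N.+1 j) w|) (Ordinal iN)).
Qed.

Lemma grid_sup_cvg w : grid_sup N w @[N --> \oo] --> path_sup T Z w.
Proof.
apply/cvgrPdist_lt => e e0.
have [c c0 cw] := Z_holder_pos w.
have hs := Z_has_sup w.
have [_ [s sT <-] Zs] := sup_adherent (divr_gt0 e0 (ltr0Sn _ 1)) hs.
rewrite -/(path_sup T Z w) in Zs.
pose b := c * Num.sqrt T.
have b0 : 0 <= b by rewrite mulr_ge0// sqrtr_ge0.
exists (Num.truncn (2 * b / e)).+1 => // N /= bN.
rewrite ger0_norm ?subr_ge0 ?grid_sup_le_path_sup//.
have [i iN si] := grid_near T0 N sT.
have GN : `|Z (grid T N i) w| <= grid_sup N w.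
  have iN' : (i < (16 ^ N).+1)%N by rewrite ltnS.
  exact: (le_bigmax _ (fun j : 'I_(16 ^ N).+1 => `|Z (grid T N j) w|) (Ordinal iN')).
have Zi : `|Z s w - Z (grid T N i) w| <= b / 4 ^+ N.
  apply: le_trans (cw _ _ (grid_itv T0 iN) sT) _.
  by rewrite /b -mulrA -sqrt16 ler_wpM2l// ler_wsqrtr.
have : b / 4 ^+ N < e / 2.
  rewrite ltr_pdivrMr ?exprn_gt0//.
  have : 2 * b / e < 4 ^+ N.
    apply: lt_le_trans (truncnS_gt _) _; rewrite -natrX ler_nat.
    by rewrite (leq_trans bN)// ltnW// ltn_expl.
  by rewrite ltr_pdivrMr//; lra.
have := ler_normD (Z s w - Z (grid T N i) w) (Z (grid T N i) w).
by rewrite subrK; lra.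
Qed.

Lemma measurable_path_sup : measurable_fun setT (path_sup T Z).
Proof.
apply: (@measurable_fun_cvg _ _ _ setT grid_sup) => //.
  by move=> N; exact: all_moments_measurable (grid_sup_moments N).
by move=> w _; exact: grid_sup_cvg.
Qed.

Lemma path_sup_ge0 w : 0 <= path_sup T Z w.
Proof. exact: le_trans (grid_sup_ge0 0 w) (grid_sup_le_path_sup 0 w). Qed.

(** The suprema over the grids increase to the supremum of the path, and
C_T^p <= 1 + C_T^(2m) as soon as 2m >= p. *)
Lemma expectation_path_sup_lty (p : R) : 0 <= p ->
  (\int[P]_w (path_sup T Z w `^ p)%:E < +oo)%E.
Proof.
move=> p0; have mS := measurable_path_sup.
pose m := Num.truncn p; have [c Gc] := grid_sup_moment_bounded m.
have Sc : (\int[P]_w (path_sup T Z w ^+ m.+3.*2)%:E <= c%:E)%E.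
  apply: (@integral_monotone_limit _ _ _ P _ (fun N w => grid_sup N w ^+ m.+3.*2)).
  - exact: measurable_funX.
  - move=> N; exact: all_moments_measurable (all_momentsX _ (grid_sup_moments N)).
  - by move=> N w; rewrite exprn_ge0.
  - by move=> w i j ij; rewrite lerXn2r ?nnegrE// grid_sup_nondecreasing.
  - by move=> w; exact: cvg_pow (@grid_sup_cvg w).
  - move=> N; have aG := all_momentsX m.+3.*2 (grid_sup_moments N).
    rewrite -[leLHS]fineK; first by rewrite lee_fin; exact: Gc.
    exact/integrable_fin_num/all_moments_integrable.
apply: (@le_lt_trans _ _ (\int[P]_w (1 + (path_sup T Z w ^+ m.+3.*2)%:E))%E).
  apply: ge0_le_integral => //.
  - by move=> w _; rewrite lee_fin powR_ge0.
  - apply/measurable_EFinP; exact: measurableT_comp (measurable_powR p) mS.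
  - apply: emeasurable_funD => //; apply/measurable_EFinP; exact: measurable_funX.
  - move=> w _; rewrite -EFinD lee_fin.
    have S0 := path_sup_ge0 w; have [S1|S1] := leP (path_sup T Z w) 1.
      apply: (@le_trans _ _ 1); last by rewrite lerDl exprn_ge0.
      have -> : 1 = 1 `^ p :> R by rewrite powR1.
      by rewrite ge0_ler_powR// ?nnegrE.
    rewrite -powR_mulrn// ler_wpDl// ler_powR ?(ltW S1)//.
    have pm : p < m.+1%:R by exact: truncnS_gt.
    rewrite (le_trans (ltW pm))// ler_nat -addnn.
    exact: leq_trans (leqW (leqnSn m.+1)) (leq_addr _ _).
rewrite ge0_integralD//; last 2 first.
- by move=> w _; rewrite lee_fin exprn_ge0// path_sup_ge0.
- by apply/measurable_EFinP; exact: measurable_funX.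
rewrite integral_cst//= probability_setT mule1.
by rewrite lte_add_pinfty ?ltry// (le_lt_trans Sc)// ltry.
Qed.

End path_sup_moments.

(** * The Hermite process *)

Section hermite.
Context {d : measure_display} {Omega : measurableType d} {R : realType}.
Variables (P : probability Omega R) (B : R -> Omega -> R).
Hypothesis hB : two_sided_brownian_motion P B.
Local Notation "''EE' X" := (Rintegral P setT X) (at level 8, X at level 8).

(** Any choice of approximating elementary integrands for the two integrals will do:
the difference of the step integrals approximates Y1 - Y2 in L2. *)
Lemma multiple_integral_increment_approx q (f1 f2 : q.-tuple (measurableTypeR R) -> R)
    (Y1 Y2 : Omega -> R) :
  is_multiple_integral P B f1 Y1 -> is_multiple_integral P B f2 Y2 ->
  forall e, 0 < e -> exists S,
  [/\ all_moments P S,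
    forall m alpha, 'EE (fun w => S w ^+ 2) < alpha ->
      'EE (fun w => S w ^+ m.*2) <= chaos_const q m * alpha ^+ m &
    (\int[P]_w ((Y1 w - Y2 w - S w) ^+ 2)%:E <= e%:E)%E].
Proof.
move=> [mY1 [k1 [_ Y1k]]] [mY2 [k2 [_ Y2k]]] e e0.
(* Each of the two errors enters with the factor 2, and 2 del^2 + 2 del^2 = e. *)
pose del := Num.sqrt e / 2.
have del0 : 0 < del by rewrite divr_gt0// sqrtr_gt0.
have del2 : 4 * del ^+ 2 = e.
  by rewrite /del exprMn sqr_sqrtr ?(ltW e0)//; field.
have small (u : nat -> \bar R) : u n @[n --> \oo] --> 0%E ->
    \forall n \near \oo, (u n <= del%:E)%E.
  move=> /fine_cvgP[ufin /cvgrPdist_le/(_ _ del0)] ule.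
  near=> n.
  have un : u n \is a fin_num by near: n.
  rewrite -(fineK un) lee_fin.
  have : `|0 - fine (u n)| <= del by near: n.
  by rewrite sub0r normrN; apply: le_trans; exact: ler_norm.
have [n [n1 n2]] : exists n,
   (Lnorm P 2%:E (fun w => (step_integral B (k1 n) w - Y1 w)%:E) <= del%:E)%E /\
   (Lnorm P 2%:E (fun w => (step_integral B (k2 n) w - Y2 w)%:E) <= del%:E)%E.
  have := small _ Y1k; have := small _ Y2k.
  move=> [N2 _ h2] [N1 _ h1]; exists (maxn N1 N2); split.
    by apply: h1; rewrite /= leq_maxl.
  by apply: h2; rewrite /= leq_maxr.
have [aS S_hyp] := step_integral_hypercontractive hB (k1 n) (k2 n).
exists (fun w => step_integral B (k1 n) w - step_integral B (k2 n) w); split=> //.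
have mstep k : measurable_fun setT (step_integral B k : Omega -> R).
  apply: measurable_sum => i; apply: measurable_funM => //.
  apply: measurable_prod => j _; apply: measurable_funB; exact: bm_measurable hB _.
have m1 : measurable_fun setT (fun w => ((step_integral B (k1 n) w - Y1 w) ^+ 2)%:E).
  by apply/measurable_EFinP; apply: measurable_funX; exact: measurable_funB.
have m2 : measurable_fun setT (fun w => ((step_integral B (k2 n) w - Y2 w) ^+ 2)%:E).
  by apply/measurable_EFinP; apply: measurable_funX; exact: measurable_funB.
apply: (@le_trans _ _ (\int[P]_w (2%:E * ((step_integral B (k1 n) w - Y1 w) ^+ 2)%:E +
    2%:E * ((step_integral B (k2 n) w - Y2 w) ^+ 2)%:E))%E).
  apply: ge0_le_integral => //.
  - by move=> w _; rewrite lee_fin sqr_ge0.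
  - apply/measurable_EFinP; apply: measurable_funX; apply: measurable_funB.
      exact: measurable_funB.
    exact: measurable_funB.
  - by apply: emeasurable_funD; exact: measurable_funeM.
  - move=> w _; rewrite -!EFinM -EFinD lee_fin.
    set u := step_integral _ _ _; set v := step_integral _ _ _.
    have -> : Y1 w - Y2 w - (u - v) = (v - Y2 w) - (u - Y1 w) by ring.
    by have := sqr_ge0 ((v - Y2 w) + (u - Y1 w)); lra.
rewrite ge0_integralD//; first last.
- exact: measurable_funeM.
- by move=> w _; rewrite -EFinM lee_fin mulr_ge0// sqr_ge0.
- exact: measurable_funeM.
- by move=> w _; rewrite -EFinM lee_fin mulr_ge0// sqr_ge0.
rewrite !ge0_integralZl_EFin//; [|by move=> w _; rewrite lee_fin sqr_ge0..].
apply: (@le_trans _ _ (2%:E * (del ^+ 2)%:E + 2%:E * (del ^+ 2)%:E)%E).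
  by apply: leeD; rewrite lee_pmul2l//; apply: sqr_integral_Lnorm => //; exact: ltW.
by rewrite -!EFinM -EFinD lee_fin; lra.
Unshelve. all: by end_near. Qed.

Variables (T H : R) (q : nat) (Z : R -> Omega -> R).
Hypothesis T0 : 0 < T.
Hypothesis hH : 1 / 2 < H.
Hypothesis hZ : hermite_process P B q H Z.

Let C0 m : 0 <= chaos_const q m :> R.
Proof. by rewrite (le_trans ler01)// chaos_const_ge1. Qed.

Let itv_ge0 t : t \in `[0, T] -> 0 <= t.
Proof. by rewrite in_itv/= => /andP[]. Qed.

Let increment_approx s t : s \in `[0, T] -> t \in `[0, T] ->
  forall e, 0 < e -> exists S,
  [/\ all_moments P S,
    forall m alpha, 'EE (fun w => S w ^+ 2) < alpha ->
      'EE (fun w => S w ^+ m.*2) <= chaos_const q m * alpha ^+ m &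
    (\int[P]_w ((Z t w - Z s w - S w) ^+ 2)%:E <= e%:E)%E].
Proof.
move=> sT tT.
exact: multiple_integral_increment_approx (hermite_integral hZ (itv_ge0 tT))
  (hermite_integral hZ (itv_ge0 sT)).
Qed.

Let measurable_increment s t : s \in `[0, T] -> t \in `[0, T] ->
  measurable_fun setT (fun w => Z t w - Z s w).
Proof.
move=> sT tT; apply: measurable_funB.
  by have [] := hermite_integral hZ (itv_ge0 tT).
by have [] := hermite_integral hZ (itv_ge0 sT).
Qed.

Let increment_moments s t : s \in `[0, T] -> t \in `[0, T] ->
  all_moments P (fun w => Z t w - Z s w).
Proof.
move=> sT tT; apply: (@l2_limit_moments _ _ _ P _ (chaos_const q)) => //.
- exact: measurable_increment.
- exact: increment_approx.
Qed.

Lemma hermite_moments t : t \in `[0, T] -> all_moments P (Z t).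
Proof.
move=> tT; have i0 : 0 \in `[0, T] by rewrite in_itv/= lexx ltW.
have := increment_moments i0 tT.
by under eq_fun do rewrite (hermite_start hZ) subr0.
Qed.

Definition hermite_moment_const m : R := 2 ^+ m.*2 * (chaos_const q m * 5 ^+ m + 1).

Lemma hermite_moment_const_gt0 m : 0 < hermite_moment_const m.
Proof. by rewrite mulr_gt0 ?exprn_gt0// ltr_wpDl// mulr_ge0// exprn_ge0. Qed.

Lemma hermite_hyper s t m alpha : s \in `[0, T] -> t \in `[0, T] ->
  0 < alpha -> 'EE (fun w => (Z t w - Z s w) ^+ 2) <= alpha ->
  'EE (fun w => (Z t w - Z s w) ^+ m.+1.*2) <=
  hermite_moment_const m.+1 * alpha ^+ m.+1.
Proof.
move=> sT tT a0 h.
have fin k : (\int[P]_w ((Z t w - Z s w) ^+ k)%:E)%E \is a fin_num.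
  exact/integrable_fin_num/all_moments_integrable/all_momentsX/increment_moments.
rewrite -lee_fin fineK//; apply: (@l2_limit_hypercontractive _ _ _ P _ (chaos_const q)) => //.
- exact: measurable_increment.
- exact: increment_approx.
- by rewrite -(fineK (fin 2)) lee_fin.
Qed.

Lemma hermite_holder_half w : exists c, forall s t,
  s \in `[0, T] -> t \in `[0, T] -> `|Z t w - Z s w| <= c * Num.sqrt `|t - s|.
Proof.
have half_gt0 : 0 < 2^-1 :> R by [].
have half_lt : 2^-1 < H by move: hH; rewrite div1r.
have [c cw] := hermite_holder hZ w half_gt0 half_lt T.
by exists c => s t sT tT; rewrite -powR12_sqrt//; exact: cw.
Qed.

Lemma hermite_measurable_path_sup : measurable_fun setT (path_sup T Z).
Proof.
apply: (@measurable_path_sup _ _ _ P T Z) => //.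
- exact: hermite_start hZ.
- exact: hermite_moments.
- exact: hermite_holder_half.
Qed.

Lemma hermite_path_sup_lty p : 0 <= p ->
  (\int[P]_w (path_sup T Z w `^ p)%:E < +oo)%E.
Proof.
apply: (@expectation_path_sup_lty _ _ _ P T Z _ _ _ _ hermite_moment_const) => //.
- exact: hermite_start hZ.
- exact: hermite_moments.
- exact: hermite_holder_half.
- exact: hermite_moment_const_gt0.
- exact: hermite_hyper.
Qed.

Lemma hermite_le_path_sup w t : t \in `[0, T] -> `|Z t w| <= path_sup T Z w.
Proof.
apply: le_path_sup => //; first exact: hermite_start hZ.
exact: hermite_holder_half.
Qed.

End hermite.

(** * Pathwise positivity *)

Section pathwise.
Context {R : realType}.
Local Notation leb := (@lebesgue_measure R).

(** The supremum of the times before t1 at which x >= m is itself such a time, by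
continuity. *)
Lemma last_passage (T m t1 : R) (x : R -> R) : {within `[0, T], continuous x} ->
  t1 \in `[0, T] -> m <= x 0 ->
  exists t0, [/\ 0 <= t0, t0 <= t1, m <= x t0 &
    forall s, t0 < s -> s <= t1 -> x s < m].
Proof.
move=> cx; rewrite in_itv/= => /andP[t1_ge0 t1T] mx0.
pose A := [set s | s \in `[0, t1] /\ m <= x s].
have A0 : A 0 by split=> //; rewrite in_itv/= lexx.
have hA : has_sup A.
  split; first by exists 0.
  by exists t1 => s [+ _]; rewrite in_itv/= => /andP[].
have ubA : has_ubound A by case: hA.
have A_le s : A s -> s <= sup A by move=> As; exact: ub_le_sup.
have t0_ge0 : 0 <= sup A by exact: A_le.
have t0_le : sup A <= t1.
  apply: ge_sup; first by exists 0.
  by move=> s [+ _]; rewrite in_itv/= => /andP[].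
exists (sup A); split=> //; last first.
  move=> s As st1; rewrite ltNge; apply/negP => mxs.
  have : s <= sup A.
    apply: A_le; split=> //.
    by rewrite in_itv/= st1 (le_trans t0_ge0 (ltW As)).
  by rewrite leNgt As.
rewrite leNgt; apply/negP => xm.
have t0T : `[0, T]%classic (sup A) by rewrite /= in_itv/= t0_ge0 (le_trans t0_le).
have /subspace_continuousP/(_ _ t0T)/cvgrPdist_lt/(_ (m - x (sup A))) := cx.
rewrite subr_gt0 near_withinE => /(_ xm)/nbhs_ballP[e /= e0 te].
have [s [sA mxs] es] := sup_adherent e0 hA.
have s_le : s <= sup A by exact: A_le.
have se : ball (sup A) e s by rewrite /ball/= ger0_norm ?subr_ge0//; lra.
have sT : `[0, T]%classic s.
  by move: sA; rewrite /= !in_itv/= => /andP[-> /le_trans]; exact.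
have := te s se sT; have := ler_norm (x s - x (sup A)); rewrite distrC; lra.
Qed.

Lemma path_positive (T a sigma x0 m c : R) (b z x : R -> R) :
  0 < T -> 0 < a -> 0 < sigma -> continuous b -> (forall s, m <= b s) ->
  m <= x0 -> z 0 = 0 -> (forall s, s \in `[0, T] -> `|z s| <= c) ->
  2 * sigma * c < m -> {within `[0, T], continuous x} ->
  (forall t, t \in `[0, T] -> x t =
    x0 + \int[leb]_(s in `[0, t]) (a * (b s - x s)) + sigma * z t) ->
  forall t, t \in `[0, T] -> 0 < x t.
Proof.
move=> T0 a0 sigma0 cb mb mx0 z0 zc cm cx xE t1 t1T.
have i0 : 0 \in `[0, T] by rewrite in_itv/= lexx ltW.
have x0E : x 0 = x0.
  by rewrite xE// set_itv1 Rintegral_set1 z0 mulr0 !addr0.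
rewrite ltNge; apply/negP => xt1.
have mx : m <= x 0 by rewrite x0E.
have [t0 [t00 t01 mxt0 xlt]] := last_passage cx t1T mx.
have t1_le : t1 <= T by move: t1T; rewrite in_itv/= => /andP[].
have t0T : t0 \in `[0, T] by rewrite in_itv/= t00 (le_trans t01).
(* With I1 and I2 the integrals of the drift up to t0 and t1, a nonnegative
   contribution of the drift between t0 and t1 is incompatible with x t1 <= 0. *)
have no_gain I1 I2 : x t0 = x0 + I1 + sigma * z t0 ->
    x t1 = x0 + I2 + sigma * z t1 -> 0 <= I2 - I1 -> False.
  have := zc _ t1T; have := zc _ t0T; rewrite !ler_norml => /andP[_ h2] /andP[h3 _].
  have := ler_wpM2l (ltW sigma0) h3; have := ler_wpM2l (ltW sigma0) h2.
  by lra.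
pose f s := a * (b s - x s).
have cf : {within `[0, T], continuous f}.
  move=> s; apply: cvgM; first exact: cvg_cst.
  apply: cvgB; last exact: cx.
  exact: continuous_subspaceT.
have intf : leb.-integrable `[0, t1] (EFin \o f).
  apply: continuous_compact_integrable; first exact: segment_compact.
  apply: continuous_subspaceW cf => s /=; rewrite !in_itv/= => /andP[-> /le_trans].
  exact.
have e : \int[leb]_(s in `[0, t1]) f s - \int[leb]_(s in `[0, t0]) f s =
    \int[leb]_(s in `]t0, t1]) f s.
  by apply: Rintegral_itvB => //; rewrite bnd_simp.
have I0 : 0 <= \int[leb]_(s in `]t0, t1]) f s.
  apply: Rintegral_ge0 => s /=; rewrite in_itv/= => /andP[ts st].
  by rewrite mulr_ge0 ?(ltW a0)// subr_ge0 (le_trans (ltW (xlt _ ts st))).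
have e0 : x t0 = x0 + \int[leb]_(s in `[0, t0]) f s + sigma * z t0 by exact: xE.
have e1 : x t1 = x0 + \int[leb]_(s in `[0, t1]) f s + sigma * z t1 by exact: xE.
by apply: (no_gain _ _ e0 e1); rewrite e.
Qed.

End pathwise.

(** By compactness a positive path is bounded below by some 1 / (k + 1), and by
continuity this can be tested on the countable set of grid points. *)
Lemma measurable_positive_path {d : measure_display} {Omega : measurableType d}
    {R : realType} (T : R) (X : R -> Omega -> R) : 0 < T ->
  (forall t, t \in `[0, T] -> measurable_fun setT (X t)) ->
  (forall w, {within `[0, T], continuous (X ^~ w)}) ->
  measurable [set w | forall t : R, t \in `[0, T] -> 0 < X t w].
Proof.
move=> T0 mX cX.
rewrite (_ : [set w | _] = \bigcup_k \bigcap_N \bigcap_(i in [set i | (i <= 16 ^ N)%N])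
    [set w | k.+1%:R^-1 <= X (grid T N i) w]).
  apply: bigcup_measurable => k _; apply: bigcapT_measurable => N.
  apply: bigcap_measurableType => i iN.
  rewrite -[X in measurable X]setTI; apply: measurable_fun_ler => //.
  exact/mX/grid_itv.
apply/seteqP; split => [w /= Xw|w [k _ Xw] t tT].
  have [t tT Xt] := EVT_min (ltW T0) (cX w).
  have Xt0 := Xw t tT.
  exists (Num.truncn (X t w)^-1) => // N _ i iN /=.
  apply: le_trans (Xt _ (grid_itv T0 iN)).
  by rewrite invf_ple ?posrE// ltW// truncnS_gt.
apply: (@lt_le_trans _ _ k.+1%:R^-1) => //.
apply: (@within_continuous_ge_grid _ T T0 (X^~ w)) => // N i iN.
exact: Xw.
Qed.

Lemma seasonal_mean_continuous {R : realType} (b0 b1 Tper : R) :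
  continuous (seasonal_mean b0 b1 Tper).
Proof.
move=> t; apply: cvgD; first exact: cvg_cst.
apply: cvgM; first exact: cvg_cst.
apply: (cvg_comp (fun t => 2 * pi * t / Tper) (@sin R)).
  by apply: cvgM; [apply: cvgM; [exact: cvg_cst|exact: cvg_id]|exact: cvg_cst].
exact: continuous_sin.
Qed.

Lemma seasonal_mean_ge {R : realType} (b0 b1 Tper t : R) :
  b0 - `|b1| <= seasonal_mean b0 b1 Tper t.
Proof.
rewrite /seasonal_mean lerD2l lerNl -mulrN.
apply: le_trans (ler_norm _) _; rewrite normrM normrN ler_piMr//.
by rewrite ler_norml sin_geN1 sin_le1.
Qed.

Lemma powR_le_id {R : realType} (x p : R) : 0 <= x -> x <= 1 -> 1 <= p -> x `^ p <= x.
Proof.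
rewrite le_eqVlt => /predU1P[<- _ p1|x0 x1 p1].
  by rewrite powR0// gt_eqF// (lt_le_trans ltr01).
by rewrite -[leRHS]powRr1 ?(ltW x0)// ger_powR// x0.
Qed.

Section markov.
Context {d : measure_display} {Omega : measurableType d} {R : realType}.
Variable P : probability Omega R.

Lemma markov_powR (S : Omega -> R) (k p : R) : measurable_fun setT S ->
  (forall w, 0 <= S w) -> 0 <= k -> 1 <= p ->
  (P [set w | (1 <= k * S w)%R] <= (k `^ p)%:E * \int[P]_w (S w `^ p)%:E)%E.
Proof.
move=> mS S0 k0 p1; set A := [set w | _].
have mA : measurable A.
  rewrite -[X in measurable X]setTI; apply: measurable_fun_ler => //.
  exact: measurable_funM.
have mSp : measurable_fun setT (fun w => (S w `^ p)%:E).
  by apply/measurable_EFinP; exact: measurableT_comp (measurable_powR p) mS.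
rewrite -ge0_integralZl_EFin ?powR_ge0//; last by move=> w _; rewrite lee_fin powR_ge0.
rewrite -[A]setIT -integral_indic//.
apply: ge0_le_integral => //.
- by apply/measurable_EFinP; exact: measurable_indic.
- exact: measurable_funeM.
- move=> w _; rewrite -EFinM lee_fin -powRM// indicE.
  have [|_] := boolP (w \in A); last exact: powR_ge0.
  rewrite inE /A/= => h; have -> : 1%:R = 1 `^ p :> R by rewrite powR1.
  by rewrite ge0_ler_powR// ?nnegrE ?mulr_ge0// (le_trans ler01).
Qed.

End markov.

Theorem theorem3p5 (R : realType) (d : measure_display)
    (Omega : measurableType d) (P : probability Omega R)
    (B : R -> Omega -> R) (hB : wiener_space P B)
    (T x0 : R) (hT : 0 < T) (hx0 : 0 < x0)
    (q : nat) (hq : (1 <= q)%N) (H : R) (hH : 1 / 2 < H) (hH1 : H < 1)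
    (a b0 b1 Tper sigma0 : R) (ha : 0 < a) (hb1 : 0 <= b1) (hb : `|b1| < b0)
    (hTper : 0 < Tper) (hsigma0 : 0 < sigma0)
    (C : R) (hC : 0 < C)
    (hL : forall s t : R, s \in `[0, T] -> t \in `[0, T] ->
      (Lnorm (lebesgue_tuple q) 2%:E
         (fun xi => (hermite_kernel H q t xi - hermite_kernel H q s xi)%:E)
       <= (C * `|t - s| `^ H)%:E)%E)
    (Z : R -> Omega -> R) (hZ : hermite_process P B q H Z)
    (X : R -> Omega -> R)
    (hX : pathwise_solution P T a sigma0 x0 (seasonal_mean b0 b1 Tper) Z X) :
  let m0 := Num.min x0 (b0 - `|b1|) in
  let positive := [set w | forall t : R, t \in `[0, T] -> 0 < X t w] in
  [/\ 0 < m0,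
      measurable positive,
      (forall p : R, 1 <= p ->
         (positivity_bound P T a p Z m0 sigma0 <= P positive)%E),
      (forall p : R, 1 <= p -> (expectation P (fun w => path_sup T Z w `^ p)%R < +oo)%E) &
      (* the bound tends to 1 as m / s tends to infinity, T, a, p, Z fixed *)
      (forall p : R, 1 <= p -> forall eps : R, 0 < eps -> exists M : R, 0 < M /\
         forall m s : R, 0 < m -> 0 < s -> M <= m / s ->
           (`|positivity_bound P T a p Z m s - 1| < eps%:E)%E)].
Proof.
move=> m0 positive.
have hBM := ws_brownian hB.
have p_ge0 (p : R) : 1 <= p -> 0 <= p by exact: le_trans.
have fin_exp p : 1 <= p -> (expectation P (fun w => path_sup T Z w `^ p)%R < +oo)%E.
  by move=> p1; rewrite unlock; exact: (hermite_path_sup_lty hBM hT hH hZ (p_ge0 _ p1)).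
have mS : measurable_fun setT (path_sup T Z) by exact: (hermite_measurable_path_sup hBM hT hH hZ).
have S_sup w t : t \in `[0, T] -> `|Z t w| <= path_sup T Z w.
  exact: (hermite_le_path_sup hT hH hZ).
have S0 w : 0 <= path_sup T Z w.
  by apply: le_trans (normr_ge0 (Z 0 w)) (S_sup w 0 _); rewrite in_itv/= lexx ltW.
have m0_gt0 : 0 < m0 by rewrite lt_min hx0 subr_gt0.
have mpos : measurable positive.
  by apply: measurable_positive_path => //; [exact: sol_measurable hX|exact: sol_continuous hX].
split=> //.
- move=> p p1; rewrite /positivity_bound unlock.
  pose k := sigma0 * (2 + a * T) / m0.
  have k0 : 0 <= k.
    by rewrite /k divr_ge0 ?(ltW m0_gt0)// mulr_ge0 ?(ltW hsigma0)// addr_ge0// mulr_ge0 ?(ltW ha)// ltW.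
  pose A := [set w | 1 <= k * path_sup T Z w].
  have mA : measurable A.
    rewrite -[X in measurable X]setTI; apply: measurable_fun_ler => //.
    exact: measurable_funM.
  have [N [mN PN0 NE]] := sol_equation hX.
  have sub : ~` A `<=` positive `|` N.
    move=> w /negP; rewrite -ltNge => kw.
    have [Nw|Nw] := pselect (N w); [by right|left].
    have eqw : forall t, t \in `[0, T] -> X t w = x0 +
        \int[lebesgue_measure]_(s in `[0, t]) (a * (seasonal_mean b0 b1 Tper s - X s w)) +
        sigma0 * Z t w by apply: contrapT => /NE.
    apply: (@path_positive _ T a sigma0 x0 m0 (path_sup T Z w)
      (seasonal_mean b0 b1 Tper) (Z^~ w) (X^~ w)) => //.
    + exact: seasonal_mean_continuous.
    + by move=> s; rewrite ge_min seasonal_mean_ge orbT.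
    + by rewrite ge_min lexx.
    + exact: hermite_start hZ w.
    + by move=> s; exact: S_sup.
    + have : sigma0 * (2 + a * T) * path_sup T Z w < m0.
        by move: kw; rewrite /k mulrAC ltr_pdivrMr// mul1r.
      apply: le_lt_trans; rewrite mulrC [leRHS]mulrC ler_wpM2l// [leLHS]mulrC.
      by rewrite ler_wpM2l ?(ltW hsigma0)// lerDl mulr_ge0// ltW.
    + exact: sol_continuous hX w.
  apply: (@le_trans _ _ (P (~` A))).
    rewrite probability_setC// leeB//.
    exact: markov_powR.
  apply: (@le_trans _ _ (P (positive `|` N))).
    by apply: le_measure => //; rewrite inE; [exact: measurableC|exact: measurableU].
  apply: le_trans (measureU2 _ mpos mN) _.
  by rewrite [X in (_ + X <= _)%E](_ : _ = 0%E) ?adde0//; exact: PN0.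
- move=> p p1 eps eps0.
  have Efin : (expectation P (fun w => path_sup T Z w `^ p)%R \is a fin_num)%E.
    rewrite ge0_fin_numE ?fin_exp// expectation_ge0// => w.
    exact: powR_ge0.
  rewrite /positivity_bound; set E := expectation _ _ in Efin *.
  have E0 : 0 <= fine E by rewrite fine_ge0// expectation_ge0// => w; exact: powR_ge0.
  have aT0 : 0 < 2 + a * T by rewrite ltr_wpDr// mulr_ge0// ltW.
  have r0 : 0 < 1 + fine E / eps by rewrite ltr_wpDr// divr_ge0// ltW.
  (* With this M, x = s (2 + a T) / m is at most 1 / (1 + E / eps), and so
     x^p E <= x E < eps. *)
  exists ((2 + a * T) * (1 + fine E / eps)); split; first by rewrite mulr_gt0.
  move=> m s m_gt0 s_gt0 Mms.
  pose x := s * (2 + a * T) / m.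
  have x_ge0 : 0 <= x by rewrite divr_ge0 ?mulr_ge0 ?(ltW m_gt0) ?(ltW s_gt0) ?(ltW aT0).
  have x_le : x <= (1 + fine E / eps)^-1.
    rewrite -[leRHS]mul1r ler_pdivlMr// /x mulrAC ler_pdivrMr// mul1r.
    by move: Mms; rewrite ler_pdivlMr// => h; rewrite -mulrA mulrC.
  have x_le1 : x <= 1.
    by apply: le_trans x_le _; rewrite invf_le1// lerDl divr_ge0// ltW.
  rewrite -(fineK Efin) -EFinM -!EFinB abse_EFin lte_fin -/x.
  rewrite addrAC subrr sub0r normrN ger0_norm; last by rewrite mulr_ge0// powR_ge0.
  apply: (@le_lt_trans _ _ ((1 + fine E / eps)^-1 * fine E)).
    by rewrite ler_wpM2r// (le_trans (powR_le_id _ _ p1)).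
  rewrite mulrC ltr_pdivrMr// mulrDr mulr1 mulrC divfK ?gt_eqF//.
  by rewrite ltrDr.
Qed.
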